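(* Let $a,b,c,\alpha\in\mathbb{R}$ with $c<0$, $1/2<\alpha<1$ and $a<-|b|$. Then the stability of the equation $D^{\alpha}x(t)+c\,D^{2\alpha}x(t)=a\,x(t)+b\,x(t-\tau)$ is independent of the delay $\tau$.
   Context: $D^{\mu}$ denotes the Caputo fractional derivative (base point $0$) in $t$: for $m\in\mathbb{N}$ and $m-1<\mu<m$, $D^{\mu}f(t)=\frac{1}{\Gamma(m-\mu)}\int_0^t (t-s)^{m-\mu-1}f^{(m)}(s)\,ds$, and $D^{m}f=f^{(m)}$. The equation is considered for $t>0$ with delay $\tau\ge 0$ and a prescribed history on $[-\tau,0]$ (together with a prescribed value $x'(0)$ since $1<2\alpha<2$). Characteristic equation: $\lambda^{\alpha}+c\lambda^{2\alpha}=a+b\,e^{-\lambda\tau}$ (principal branch of powers). Stability: for a given $\tau\ge0$ the equation is called stable if all its solutions are bounded as $t\to\infty$, and unstable if it is not stable. ''The stability is independent of the delay $\tau$'' means: if the equation with $\tau=0$, i.e. $D^{\alpha}x(t)+c\,D^{2\alpha}x(t)=(a+b)x(t)$, is stable (respectively, unstable), then the delayed equation is stable (respectively, unstable) for all $\tau\ge 0$. *)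

(* Defs.v *)
From HB Require Import structures.
From mathcomp Require Import all_boot all_order all_algebra.
From mathcomp Require Import all_classical all_reals all_analysis.

Set Implicit Arguments.
Unset Strict Implicit.
Unset Printing Implicit Defensive.

Import Order.TTheory GRing.Theory Num.Theory.
Import numFieldNormedType.Exports.

Local Open Scope classical_set_scope.
Local Open Scope ring_scope.

(* Only meaningful for z > 0, where the integral converges. *)
Definition Gamma {R : realType} (z : R) : R :=
  \int[@lebesgue_measure R]_(t in `]0, +oo[) (t `^ (z - 1) * expR (- t)).

(* The natural number m with m - 1 < mu <= m, for mu > 0. *)
Definition caputo_order {R : realType} (mu : R) : nat := `|Num.ceil mu|%N.

Definition caputo_kernel {R : realType} (mu : R) (f : R -> R) (t s : R) : R :=
  let m := caputo_order mu in
  (t - s) `^ (m%:R - mu - 1) * derive1n m f s.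

Definition caputo {R : realType} (mu : R) (f : R -> R) (t : R) : R :=
  let m := caputo_order mu in
  if mu == m%:R then derive1n m f t
  else (Gamma (m%:R - mu))^-1 *
       \int[@lebesgue_measure R]_(s in `]0, t[) caputo_kernel mu f t s.

(* [derive1n] and [\int] are total functions; this says that, at t > 0,
   [caputo] is computed from genuine derivatives and a convergent integral. *)
Definition caputo_defined {R : realType} (mu : R) (f : R -> R) (t : R) : Prop :=
  let m := caputo_order mu in
  (forall k s, (k < m)%N -> 0 < s <= t -> derivable (derive1n k f) s 1) /\
  (mu != m%:R ->
   (@lebesgue_measure R).-integrable `]0, t[
     (fun s => (caputo_kernel mu f t s)%:E)).

(* x solves  D^alpha x(t) + c D^(2 alpha) x(t) = a x(t) + b x(t - tau),  t > 0,
   with history x = phi on [-tau, 0] and x'(0) = v.  Since the history and the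
   solution need not join smoothly, x'(0) is the right derivative.  Values of
   x and phi outside [-tau, +oo[ and [-tau, 0], respectively, play no role. *)
Definition is_solution {R : realType} (a b c alpha tau : R)
    (phi : R -> R) (v : R) (x : R -> R) : Prop :=
  [/\ {within `[- tau, +oo[, continuous x},
      {in `[- tau, 0], x =1 phi},
      (h^-1 * (x h - x 0)) @[h --> 0^'+] --> v &
      forall t, 0 < t ->
        [/\ caputo_defined alpha x t, caputo_defined (2 * alpha) x t &
            caputo alpha x t + c * caputo (2 * alpha) x t =
            a * x t + b * x (t - tau)]].

Definition stable {R : realType} (a b c alpha tau : R) : Prop :=
  forall (phi : R -> R) (v : R) (x : R -> R),
    is_solution a b c alpha tau phi v x -> bounded_near x +oo.

Definition unstable {R : realType} (a b c alpha tau : R) : Prop :=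
  ~ stable a b c alpha tau.

(* The undelayed equation is the case tau = 0, where a x(t) + b x(t - 0) is
   (a + b) x(t) and the history reduces to the initial value x(0). *)
Definition stability_delay_independent {R : realType} (a b c alpha : R) : Prop :=
  (stable a b c alpha 0 -> forall tau : R, 0 <= tau -> stable a b c alpha tau) /\
  (unstable a b c alpha 0 ->
   forall tau : R, 0 <= tau -> unstable a b c alpha tau).

(* Main.v *)
(* With c < 0 and a < - |b| the equation is unstable for every delay, so both
   implications hold.  An unbounded solution with zero history and x(0) = 0,
   x'(0) = 1 is written down as x = \sum_n x_n, where x_n is a finite combination
   of delayed powers max(0, t - k tau)^(1 + n alpha).  Caputo derivatives send
   such a power to a multiple of a lower power by a Beta integral, so that the
   equation becomes the recursion
     - c D^(2 alpha) x_(n+2) = D^alpha x_(n+1) - a x_n - b x_n(. - tau),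
   with x_0 = t.  Its coefficients decay faster than any geometric sequence, so
   the series can be differentiated and integrated termwise.  All delayed powers
   in x_n have the same exponent, hence fractional integration of x_n multiplies
   it by a positive constant while raising that exponent; as |b| < - a this shows
   inductively that every x_n is nonnegative, whence x(t) >= x_0(t) = t. *)

Require Import Defs.
From mathcomp Require Import all_boot all_order all_algebra.
From mathcomp Require Import ring lra.
From mathcomp Require Import all_classical all_reals all_analysis.
From mathcomp Require Import measurable_realfun.

Set Implicit Arguments.
Unset Strict Implicit.
Unset Printing Implicit Defensive.

Import Order.TTheory GRing.Theory Num.Theory.
Import numFieldNormedType.Exports.

Local Open Scope classical_set_scope.
Local Open Scope ring_scope.

(** * Change of variables under affine maps of the line *)

Section Affine.
Context {R : realType}.
Notation mu := (@lebesgue_measure R).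
Notation aff k b := (fun x : measurableTypeR R => k * x + b : measurableTypeR R).

Lemma measurable_affine (k b : R) : measurable_fun setT (aff k b).
Proof. by apply: measurable_funD => //; exact: measurable_funM. Qed.

(** Lebesgue measure is determined by its values on half-open intervals, so it suffices to compute
    the scaled pushforward there. For negative [k] the preimage of such an interval is half-open on
    the other side, with the same length. *)
Lemma lebesgue_measure_affine (k b : R) (A : set R) : k != 0 -> measurable A ->
  (`|k|%:E * pushforward mu (aff k b) A = mu A)%E.
Proof.
move=> k0 mA; have mf := measurable_affine k b.
pose nu := mscale (NngNum (normr_ge0 k))
  (measure_function_pushforward__canonical__measure_function_Measure mu mf).
rewrite -[LHS]/(nu A).
apply/esym/lebesgue_measure_unique => //= _ [[x y]] _ <-.
rewrite /mscale /= /pushforward /=.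
case: (ltrP 0 k) => [kp|]; last rewrite le_eqVlt (negPf k0) => /= kn.
  rewrite (_ : _ @^-1` _ = `](x - b) / k, (y - b) / k]%classic); last first.
    apply/seteqP; split => z /=; rewrite !in_itv /= ltr_pdivrMr// ler_pdivlMr//.
      by rewrite ltrBlDr lerBrDr mulrC.
    by rewrite ltrBlDr lerBrDr mulrC.
  rewrite !lebesgue_measure_itv /= !lte_fin ltr_pM2r ?invr_gt0// ltrD2r.
  case: ifP => _; last by rewrite mule0.
  by rewrite gtr0_norm// -!EFinB -EFinM; congr (_%:E); field.
rewrite (_ : _ @^-1` _ = `[(y - b) / k, (x - b) / k[%classic); last first.
  apply/seteqP; split => z /=; rewrite !in_itv /= ltr_ndivlMr// ler_ndivrMr//.
    by rewrite ltrBlDr lerBrDr mulrC andbC.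
  by rewrite ltrBlDr lerBrDr mulrC andbC.
rewrite !lebesgue_measure_itv /= !lte_fin ltr_nM2r ?invr_lt0// ltrD2r.
case: ifP => _; last by rewrite mule0.
by rewrite ltr0_norm// -!EFinB -EFinM; congr (_%:E); field; rewrite ?lt_eqF.
Qed.

Lemma ge0_integral_affine (k b : R) (D : set R) (f : R -> \bar R) : k != 0 ->
  measurable D -> measurable_fun D f -> {in D, forall y, (0 <= f y)%E} ->
  (\int[mu]_(x in D) f x =
   `|k|%:E * \int[mu]_(x in (fun x => (k * x + b)%R) @^-1` D) f (k * x + b)%R)%E.
Proof.
move=> k0 mD mf f0; have mphi := measurable_affine k b.
rewrite -[X in (_ * X)%E](ge0_integral_pushforward mphi)//.
rewrite -(ge0_integral_mscale _ _ (NngNum (normr_ge0 k)))//; last first.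
  by move=> x Dx; rewrite f0// inE.
by apply: eq_measure_integral => A mA _; exact/esym/lebesgue_measure_affine.
Qed.

End Affine.

(** * Integrals of powers, and Beta integrals of delayed powers *)

Section PowerIntegrals.
Context {R : realType}.
Notation mu := (@lebesgue_measure R).
Notation I01 := (`](0 : R), (1 : R)[%classic).

Lemma gt0_powRD (x r s : R) : 0 < x -> x `^ (r + s) = x `^ r * x `^ s.
Proof. by move=> x0; rewrite powRD// (gt_eqF x0) implybT. Qed.

Lemma integral_powR_itvcc (nu x : R) : -1 < nu -> 0 < x < 1 ->
  (\int[mu]_(u in `[x, 1%R]) (u `^ nu)%:E = ((1 - x `^ (nu + 1)) / (nu + 1))%:E)%E.
Proof.
move=> nu1 /andP[x0 x1].
have nu0 : nu + 1 != 0 by rewrite gt_eqF// -ltrBlDr sub0r.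
pose F (u : R) : R := u `^ (nu + 1) / (nu + 1).
have dF (u : R) : 0 < u -> is_derive u 1 F (u `^ nu).
  move=> u0; have := is_derive1_powR (nu + 1) u0; rewrite addrK => d1.
  have -> : u `^ nu = (nu + 1)^-1 *: ((nu + 1) * u `^ nu) by rewrite scalerA mulVf// scale1r.
  have -> : F = (fun z : R => (nu + 1)^-1 *: z `^ (nu + 1)) by apply/funext => z; rewrite /F mulrC.
  exact: is_deriveZ.
have cF (u : R) : 0 < u -> {for u, continuous F}.
  by move=> /dF ?; apply/differentiable_continuous/derivable1_diffP/ex_derive.
rewrite (@continuous_FTC2 _ _ F)//.
- by rewrite -EFinB; congr (_%:E); rewrite /F powR1 mulrBl.
- apply: derivable_within_continuous => u; rewrite in_itv/= => /andP[xu _].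
  by apply: derivable_powR; rewrite in_itv/= andbT (lt_le_trans x0).
- split.
  + by move=> u; rewrite in_itv/= => /andP[xu _]; have /(_ (lt_trans x0 xu))[] := dF u.
  + by apply: cvg_at_right_filter; exact: cF.
  + by apply: cvg_at_left_filter; exact: cF.
- move=> u; rewrite in_itv/= => /andP[xu _]; rewrite derive1E.
  by have /(_ (lt_trans x0 xu)) := dF u => ?; rewrite derive_val.
Qed.

(** The singularity at 0 for negative [nu] is approached by monotone convergence along compact
    intervals, on which the fundamental theorem of calculus applies. *)
Lemma integral_powR_itvoo (nu : R) : -1 < nu ->
  (\int[mu]_(u in I01) (u `^ nu)%:E = ((nu + 1)^-1)%:E)%E.
Proof.
move=> nu1; have nu0 : 0 < nu + 1 by rewrite -ltrBlDr sub0r.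
have mp D : measurable_fun D (fun u : R => (u `^ nu)%:E).
  by apply/measurable_EFinP; apply: measurable_funTS.
rewrite integral_itv_bndo_bndc//.
(* Starting from [n.+2] keeps the left endpoint strictly below 1 for every [n], as
   [integral_powR_itvcc] demands. *)
pose F n : set R := `[n.+2%:R^-1, 1]%classic.
have -> : `]0%R, 1%R]%classic = \bigcup_n F n.
  apply/seteqP; split => u /=.
    rewrite in_itv/= => /andP[u0 u1].
    exists (Num.truncn u^-1) => //; rewrite /F/= in_itv/= u1 andbT.
    rewrite invf_ple ?posrE// ltW// (lt_trans (truncnS_gt _))// ltr_nat//.
  move=> [n _]; rewrite /F/= !in_itv/= => /andP[nu_ ->].
  by rewrite andbT (lt_le_trans _ nu_)// invr_gt0.
have cvgF : (\int[mu]_(x in F i) (x `^ nu)%:E @[i --> \oo] -->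
    \int[mu]_(x in \bigcup_i F i) (x `^ nu)%:E)%E.
  have := @ge0_nondecreasing_set_cvg_integral _ (measurableTypeR R) R F (fun u => (u `^ nu)%:E) mu; apply => //.
  - apply/nondecreasing_seqP => n; rewrite /F subsetEset => u /=.
    rewrite !in_itv/= => /andP[nu_ ->]; rewrite andbT (le_trans _ nu_)//.
    by rewrite lef_pV2 ?posrE// ler_nat.
  - by move=> n; exact: measurable_itv.
  - by move=> n; exact: mp.
  - by move=> n u Fnu; rewrite lee_fin powR_ge0.
rewrite -(cvg_lim _ cvgF)//; apply: cvg_lim => //.
have -> : (fun i => \int[mu]_(x in F i) (x `^ nu)%:E)%E =
    (fun i => ((1 - (i.+2%:R^-1) `^ (nu + 1)) / (nu + 1))%:E).
  apply/funext => i; rewrite integral_powR_itvcc// invr_gt0 ltr0n/=.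
  by rewrite invf_lt1 ?ltr1n.
apply: cvg_EFin; first by apply: nearW.
rewrite -[X in _ --> X]mul1r; apply: cvgMr_tmp.
rewrite -[X in _ --> X]subr0; apply: cvgB; first exact: cvg_cst.
have /cvg_at_rightP := powR_cvg0 nu0; apply; split => [n|]; first by rewrite invr_gt0.
by have := @cvg_harmonic R; rewrite -cvg_shiftS.
Qed.
Lemma integrable_powR01 (nu : R) : -1 < nu ->
  mu.-integrable I01 (fun u => (u `^ nu)%:E).
Proof.
move=> nu1; apply/integrableP; split.
  by apply/measurable_EFinP; apply: measurable_funTS.
under eq_integral do rewrite gee0_abs ?lee_fin ?powR_ge0//.
by rewrite integral_powR_itvoo// ltry.
Qed.

Lemma integrable_onem_powR01 (nu : R) : -1 < nu ->
  mu.-integrable I01 (fun u => ((1 - u) `^ nu)%:E).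
Proof.
move=> nu1; apply/integrableP; split.
  apply/measurable_EFinP; apply: measurable_funTS.
  by apply: (measurableT_comp (measurable_powR _)); exact: measurable_funB.
under eq_integral do rewrite gee0_abs ?lee_fin ?powR_ge0//.
have mp : measurable_fun I01 (fun u : R => (u `^ nu)%:E).
  by apply/measurable_EFinP; apply: measurable_funTS.
have := @ge0_integral_affine R (-1) 1 I01 (fun u => (u `^ nu)%:E).
have k0 : (-1 : R) != 0 by rewrite oppr_eq0 oner_eq0.
have p0 : {in I01, forall u : R, (0 <= (u `^ nu)%:E)%E}.
  by move=> u _; rewrite lee_fin powR_ge0.
rewrite integral_powR_itvoo// => /(_ k0 (measurable_itv _) mp p0) h.
rewrite [ltLHS](_ : _ = ((nu + 1)^-1)%:E) ?ltry// h.
rewrite normrN1 mul1e (_ : _ @^-1` _ = I01).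
  by apply: eq_integral => u _; rewrite mulN1r addrC.
by apply/seteqP; split => u /=; rewrite !in_itv/= => /andP[? ?]; apply/andP; split; lra.
Qed.

(** In Euler's notation this is B(nu + 1, 1 - b). *)
Definition beta (b nu : R) : R :=
  \int[mu]_(u in I01) ((1 - u) `^ (- b) * u `^ nu).

Lemma measurable_abel (b nu t d : R) (D : set R) :
  measurable_fun D (fun s : R => ((t - s) `^ (- b) * (s - d) `^ nu)%:E).
Proof.
apply/measurable_EFinP/measurable_funTS; apply: measurable_funM.
  by apply: (measurableT_comp (measurable_powR _)); exact: measurable_funB.
by apply: (measurableT_comp (measurable_powR _)); exact: measurable_funB.
Qed.

(** Each factor is singular at one endpoint only. On either half of the interval the factor that is
    regular there is at most 2, so twice the sum of both factors is an integrable majorant. *)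
Lemma integrable_beta (b nu : R) : 0 <= b < 1 -> -1 < nu ->
  mu.-integrable I01 (fun u => ((1 - u) `^ (- b) * u `^ nu)%:E).
Proof.
move=> /andP[b0 b1] nu1.
have bd (a r : R) : -1 < r -> 2^-1 <= a <= 1 -> a `^ r <= 2.
  move=> r1 /andP[a2 a1]; have a0 : 0 < a by rewrite (lt_le_trans _ a2).
  apply: (@le_trans _ _ (a `^ (-1))).
    by apply: ger_powR; [rewrite a0|exact: ltW].
  by rewrite (powR_inv1 (ltW a0)) invf_ple ?posrE.
apply: (@le_integrable _ (measurableTypeR R) R mu I01 _ _
    (fun u => (2 * ((1 - u) `^ (- b) + u `^ nu))%:E)) => //.
- by have := @measurable_abel b nu 1 0 I01; by apply: eq_measurable_fun => u _; rewrite subr0.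
- move=> u /=; rewrite in_itv/= => /andP[u0 u1].
  have p1 := powR_ge0 (1 - u) (- b); have p2 := powR_ge0 u nu.
  rewrite lee_fin !ger0_norm ?mulr_ge0 ?addr_ge0//.
  have [u2|/ltW u2] := leP u 2^-1.
    have h : (1 - u) `^ (- b) <= 2 by apply: bd; [lra|apply/andP; split; lra].
    nra.
  have h : u `^ nu <= 2 by apply: bd => //; apply/andP; split; lra.
  nra.
- have -> : (fun u : R => (2 * ((1 - u) `^ (- b) + u `^ nu))%:E) =
    (fun u : R => (2%:E * (((1 - u) `^ (- b))%:E + (u `^ nu)%:E))%E).
    by apply/funext => u; rewrite EFinM EFinD.
  apply: integrableZl => //; apply: integrableD => //.
    by apply: integrable_onem_powR01; rewrite ltrN2.
  exact: integrable_powR01.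
Qed.

Lemma betaE (b nu : R) : 0 <= b < 1 -> -1 < nu ->
  (\int[mu]_(u in I01) ((1 - u) `^ (- b) * u `^ nu)%:E = (beta b nu)%:E)%E.
Proof.
move=> b01 nu1; rewrite /beta /Rintegral fineK//.
by apply: integrable_fin_num => //; exact: integrable_beta.
Qed.

Lemma beta_ge (b nu : R) : 0 <= b < 1 -> -1 < nu -> (nu + 1)^-1 <= beta b nu.
Proof.
move=> b01 nu1; rewrite -lee_fin -betaE// -integral_powR_itvoo//.
apply: ge0_le_integral => //=.
- by move=> u _; rewrite lee_fin powR_ge0.
- by apply/measurable_EFinP; apply: measurable_funTS.
- by have := @measurable_abel b nu 1 0 I01; by apply: eq_measurable_fun => u _; rewrite subr0.
- move=> u; rewrite in_itv/= => /andP[u0 u1]; rewrite lee_fin.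
  rewrite ler_peMl ?powR_ge0// powRN invf_ge1 ?powR_gt0 ?subr_gt0//.
  rewrite -[leRHS](powRr0 (1 - u)); apply: ger_powR; last by case/andP: b01.
  by apply/andP; split; lra.
Qed.

Lemma beta_gt0 (b nu : R) : 0 <= b < 1 -> -1 < nu -> 0 < beta b nu.
Proof.
move=> b01 nu1; apply: lt_le_trans (beta_ge b01 nu1).
by rewrite invr_gt0 -ltrBlDr sub0r.
Qed.

(** Substitution of [s = (t - d) * u + d], which pulls all powers of [t - d] out of the integral. *)
Lemma abel_itvoo (b nu d t : R) : 0 <= b < 1 -> -1 < nu -> d < t ->
  (\int[mu]_(s in `]d, t[) ((t - s) `^ (- b) * (s - d) `^ nu)%:E =
   (beta b nu * (t - d) `^ (nu + 1 - b))%:E)%E.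
Proof.
move=> b01 nu1 dt; have td : 0 < t - d by rewrite subr_gt0.
rewrite (@ge0_integral_affine R (t - d) d)//; first last.
- by move=> u _; rewrite lee_fin mulr_ge0 ?powR_ge0.
- exact: measurable_abel.
- by rewrite gt_eqF.
rewrite gtr0_norm//.
rewrite (_ : _ @^-1` _ = I01); last first.
  apply/seteqP; split => u /=; rewrite !in_itv/= => /andP[u0 u1]; apply/andP; split; nra.
rewrite (eq_integral (fun u : measurableTypeR R =>
    ((t - d) `^ (nu - b))%:E * ((1 - u) `^ (- b) * u `^ nu)%:E)%E); last first.
  move=> u /set_mem/=; rewrite in_itv/= => /andP[u0 u1].
  rewrite addrK (_ : t - ((t - d) * u + d) = (t - d) * (1 - u)); last by ring.
  rewrite !powRM ?(ltW td) ?(ltW u0) ?subr_ge0 ?(ltW u1)// -EFinM; congr (_%:E).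
  rewrite [X in _ = X * _](_ : _ = (t - d) `^ (- b) * (t - d) `^ nu); first by ring.
  by rewrite -gt0_powRD//; congr (_ `^ _); ring.
rewrite integralZl//; last exact: integrable_beta.
rewrite betaE// -!EFinM; congr (_%:E).
rewrite [RHS]mulrC mulrA; congr (_ * _).
rewrite -[X in X * _](powRr1 (ltW td)) -gt0_powRD//.
by congr (_ `^ _); ring.
Qed.

(* As 0 `^ 0 = 1, [ppow 0] is the constant 1 and not a step function. *)
Definition ppow (nu s : R) : R := Num.max 0 s `^ nu.

Lemma ppow_gt0E nu s : 0 < s -> ppow nu s = s `^ nu.
Proof. by move=> s0; rewrite /ppow max_r// ltW. Qed.

Lemma ppow_le0E nu s : s <= 0 -> nu != 0 -> ppow nu s = 0.
Proof. by move=> s0 nu0; rewrite /ppow max_l// powR0. Qed.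

Lemma ppow_ge0 nu s : 0 <= ppow nu s.
Proof. exact: powR_ge0. Qed.

Lemma measurable_ppow nu d (D : set R) : measurable_fun D (fun s => ppow nu (s - d)).
Proof.
rewrite /ppow; apply: measurable_funTS; apply: (measurableT_comp (measurable_powR _)).
by apply: measurable_maxr => //; exact: measurable_funB.
Qed.

(** The delayed power vanishes up to time [d], which leaves the Beta integral over []d, t[]. The
    last hypothesis excludes a delayed power of exponent 0, which would be 1 before [d]. *)
Lemma abel_ppow (b nu d t : R) : 0 <= b < 1 -> -1 < nu -> 0 <= d -> 0 < t ->
  0 < nu \/ d = 0 ->
  (\int[mu]_(s in `]0%R, t[) ((t - s) `^ (- b) * ppow nu (s - d))%:E =
   (beta b nu * ppow (nu + 1 - b) (t - d))%:E)%E.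
Proof.
move=> /[dup] b01 /andP[b0 b1] nu1 d0 t0 nud.
have [td|dt] := leP t d.
  have nu0 : 0 < nu by case: nud => // d00; move: (lt_le_trans t0 td); rewrite d00 ltxx.
  rewrite [in RHS]ppow_le0E ?subr_le0// ?mulr0; last by rewrite gt_eqF//; lra.
  apply: integral0_eq => s /=; rewrite in_itv/= => /andP[s0 st].
  by rewrite ppow_le0E ?mulr0 ?gt_eqF// subr_le0 (le_trans (ltW st)).
have m (D : set R) : measurable_fun D (fun s => ((t - s) `^ (- b) * ppow nu (s - d))%:E).
  apply/measurable_EFinP; apply: measurable_funM; last exact: measurable_ppow.
  by apply: measurable_funTS; apply: (measurableT_comp (measurable_powR _)); exact: measurable_funB.
have p0 s : (0 <= ((t - s) `^ (- b) * ppow nu (s - d))%:E)%E.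
  by rewrite lee_fin mulr_ge0 ?powR_ge0.
rewrite (@itv_bndbnd_setU _ R _ (BRight d)) ?bnd_simp// ge0_integral_setU//=; last first.
  apply/disj_setPS => s [/=]; rewrite !in_itv/= => /andP[_ sd] /andP[ds _].
  by move: (lt_le_trans ds sd); rewrite ltxx.
exact: m.
rewrite integral0_eq ?add0e; last first.
  move=> s /=; rewrite in_itv/= => /andP[s0 sd]; rewrite ppow_le0E ?mulr0 ?subr_le0//.
  case: nud => [/gt_eqF->//|d00]; move: (lt_le_trans s0 sd); rewrite d00 ltxx//.
rewrite ppow_gt0E ?subr_gt0// -abel_itvoo//; apply: eq_integral => s /set_mem/=.
by rewrite in_itv/= => /andP[ds _]; rewrite ppow_gt0E ?subr_gt0.
Qed.

End PowerIntegrals.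

(** * Termwise limits, derivatives and integrals of dominated series *)

Section DominatedSeries.
Context {R : realType}.
Implicit Types (u v M : R^nat).

Lemma is_cvg_series_dominated u M : (forall n, `|u n| <= M n) ->
  cvgn (series M) -> cvgn (series u).
Proof.
move=> uM cM; apply: (@normed_cvg R R^o); apply: (series_le_cvg _ _ _ cM) => n //=.
exact: le_trans (normr_ge0 _) (uM n).
Qed.

Lemma series_le_lim M n : (forall n, 0 <= M n) -> cvgn (series M) ->
  series M n <= limn (series M).
Proof.
move=> M0 cM; apply: nondecreasing_cvgn_le => //.
by apply: nondecreasing_series => k _ _.
Qed.

Lemma series_tail_le u M N : (forall n, `|u n| <= M n) -> cvgn (series M) ->
  `|limn (series u) - series u N| <= limn (series M) - series M N.
Proof.
move=> uM cM; have cu := is_cvg_series_dominated uM cM.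
have M0 n : 0 <= M n by exact: le_trans (normr_ge0 _) (uM n).
have c : `|series u m - series u N| @[m --> \oo] --> `|limn (series u) - series u N|.
  by apply: cvg_norm; apply: cvgB => //; exact: cvg_cst.
apply: (cvgr_to_le c); near=> m.
have Nm : (N <= m)%N by near: m; exact: nbhs_infty_ge.
rewrite sub_series_geq//; apply: (le_trans (ler_norm_sum _ _ _)).
apply: (@le_trans _ _ (series M m - series M N)).
  by rewrite sub_series_geq// ler_sum.
by rewrite lerB// series_le_lim.
Unshelve. all: by end_near. Qed.

(** Tannery's theorem along a filter: the tails are small uniformly in [h] by [series_tail_le], and
    a fixed partial sum converges as a finite sum. *)
Lemma cvg_series_dominated {T : Type} (F : set_system T) {FF : ProperFilter F}
    (u : nat -> T -> R) v M : cvgn (series M) ->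
  (forall n, u n h @[h --> F] --> v n) ->
  (\forall h \near F, forall n, `|u n h| <= M n) ->
  limn (series (u ^~ h)) @[h --> F] --> limn (series v).
Proof.
move=> cM uv uM.
have vM n : `|v n| <= M n.
  apply: (cvgr_to_le (cvg_norm (uv n))).
  by apply: filterS uM => h; exact.
apply/cvgrPdist_le => e e0.
have e3 : 0 < e / 3 by rewrite divr_gt0.
have [N _ /(_ N (leqnn _)) HN] : \forall N \near \oo, `|limn (series M) - series M N| <= e / 3.
  by move/cvgrPdist_le : cM => /(_ _ e3).
have cN : series (u ^~ h) N @[h --> F] --> series v N.
  elim: N {HN} => [|N IH].
    by rewrite /series/= big_geq//; under eq_fun do rewrite big_geq//; exact: cvg_cst.
  by rewrite seriesSr; under eq_fun do rewrite seriesSr; exact: cvgD.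
move/cvgrPdist_le : cN => /(_ _ e3) cN.
near=> h.
have uMh : forall n, `|u n h| <= M n by near: h.
have h1 := series_tail_le N uMh cM.
have h2 := series_tail_le N vM cM.
have h3 : `|series v N - series (u ^~ h) N| <= e / 3 by near: h.
have h4 := le_trans (ler_norm _) HN.
move: h1 h2 h3 h4; rewrite !ler_norml => /andP[? ?] /andP[? ?] /andP[? ?] ?.
by apply/andP; split; lra.
Unshelve. all: by end_near. Qed.

(** By the mean value theorem [M] also bounds the difference quotients, so that Tannery's theorem
    applies to them along the punctured neighbourhoods of 0. *)
Lemma is_derive_series (f g : nat -> R -> R) M (lo hi s : R) : lo < s < hi ->
  cvgn (series M) ->
  (forall n x, lo < x < hi -> is_derive x 1 (f n) (g n x)) ->
  (forall n x, lo < x < hi -> `|g n x| <= M n) ->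
  (forall x, lo < x < hi -> cvgn (series (f ^~ x))) ->
  is_derive s 1 (fun x => limn (series (f ^~ x))) (limn (series (g ^~ s))).
Proof.
move=> /andP[los shi] cM fg gM cf.
pose q n (h : R) := h^-1 *: (f n (h *: 1 + s) - f n s).
have n1 : \forall h \near (0 : R), lo < h *: 1 + s < hi.
  near=> h; rewrite [h *: 1]mulr1; apply/andP; split.
    by rewrite -ltrBlDr; near: h; apply: lt_nbhsr; rewrite subr_lt0.
  by rewrite -ltrBrDr; near: h; apply: lt_nbhsl; rewrite subr_gt0.
have n2 : \forall h \near 0^', lo < h *: 1 + s < hi by exact: nbhs_dnbhs n1.
have qM : \forall h \near 0^', forall n, `|q n h| <= M n.
  near=> h => n.
  have h0 : h != 0 by near: h; exact: nbhs_dnbhs_neq.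
  have : lo < h *: 1 + s < hi by near: h.
  rewrite /q [h *: 1]mulr1 => /andP[lo1 hi1].
  have mvt (a b : R) : lo < a -> b < hi -> a < b -> `|f n b - f n a| <= M n * (b - a).
    move=> la bh ab.
    have itv x : x \in `[a, b] -> lo < x < hi.
      by rewrite in_itv/= => /andP[ax xb]; rewrite (lt_le_trans la)// (le_lt_trans xb).
    have [||c cab ->] := @MVT _ (f n) (g n) a b ab.
    - by move=> x xab; apply/fg/itv; exact: subset_itv_oo_cc xab.
    - by apply: derivable_within_continuous => x /itv /fg/@ex_derive.
    - rewrite normrM [`|b - a|]gtr0_norm ?subr_gt0//; apply: ler_wpM2r; first by rewrite subr_ge0 ltW.
      by apply: gM; apply: itv; exact: subset_itv_oo_cc cab.
  rewrite normrZ normfV mulrC ler_pdivrMr ?normr_gt0//.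
  have [h_gt|h_lt] := ltrP 0 h.
    rewrite [`|h|]gtr0_norm// (le_trans (mvt _ _ _ _ _))// ?ltrDr//.
    by rewrite addrK.
  have hlt0 : h < 0 by rewrite lt_neqAle h0.
  rewrite distrC [`|h|]ltr0_norm// (le_trans (mvt _ _ _ _ _))// ?gtrDr//.
  by rewrite opprD addrC subrK.
have qg n : q n h @[h --> 0^'] --> g n s.
  have [d <-] := fg n s ltac:(by rewrite los shi).
  exact: d.
have lim := cvg_series_dominated (F := 0^') (FF := Proper_dnbhs_numFieldType 0) cM qg qM.
have eq : {near 0^', (fun h => limn (series (q ^~ h))) =1
   (fun h => h^-1 *: (limn (series (f ^~ (h *: 1 + s))) - limn (series (f ^~ s))))}.
  near=> h.
  have uMh : forall n, `|q n h| <= M n by near: h.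
  have n3 : lo < h *: 1 + s < hi by near: h.
  have c1 := cf _ n3; have c2 := cf s ltac:(by rewrite los shi).
  rewrite -lim_seriesB// -lim_seriesZ//; last exact: is_cvg_seriesB.
have lim' : (fun h => h^-1 *: (limn (series (f ^~ (h *: 1 + s))) - limn (series (f ^~ s))))
   @ 0^' --> limn (series (g ^~ s)).
  apply: cvg_trans lim; exact: near_eq_cvg.
have der : derivable (fun x => limn (series (f ^~ x))) s 1.
  by apply/cvg_ex; eexists; exact: lim'.
by split => //; apply: cvg_lim lim'.
Unshelve. all: by end_near. Qed.


Lemma integrable_series d (T : measurableType d) (mu : {measure set T -> \bar R})
    (D : set T) (h : nat -> T -> R) N : measurable D ->
  (forall n, mu.-integrable D (EFin \o h n)) ->
  mu.-integrable D (fun s => (series (h ^~ s) N)%:E) /\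
  (\int[mu]_(s in D) series (h ^~ s) N = series (fun n => \int[mu]_(s in D) h n s) N)%R.
Proof.
move=> mD ih; elim: N => [|N [IH1 IH2]].
  have e : (fun s => (series (h ^~ s) 0)%:E) = cst 0%E.
    by apply/funext => s; rewrite /series/= big_geq.
  rewrite e; split; first exact: integrable0.
  rewrite /Rintegral (eq_integral (cst 0%E)); first by rewrite integral0 /series/= big_geq.
  by move=> s _; rewrite /series/= big_geq.
have e : (fun s => (series (h ^~ s) N.+1)%:E) =
    (fun s => ((series (h ^~ s) N)%:E + (h N s)%:E)%E).
  by apply/funext => s; rewrite seriesSr.
split; first by rewrite e; apply: integrableD => //; exact: ih.
rewrite seriesSr -IH2 -RintegralD//.
  by apply: eq_Rintegral => s _; rewrite seriesSr.
Qed.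

(** All partial sums are bounded by the integrable function [limn (series M) * G s]; dominated
    convergence does the rest. *)
Lemma Rintegral_series_dominated d (T : measurableType d)
    (mu : {measure set T -> \bar R}) (D : set T) (h : nat -> T -> R) M (G : T -> R) :
  measurable D -> (forall n, measurable_fun D (h n)) ->
  mu.-integrable D (EFin \o G) -> (forall s, D s -> 0 <= G s) ->
  (forall n, 0 <= M n) -> cvgn (series M) ->
  (forall n s, D s -> `|h n s| <= M n * G s) ->
  mu.-integrable D (fun s => (limn (series (h ^~ s)))%:E) /\
  series (fun n => \int[mu]_(s in D) h n s)%R @ \oo -->
    (\int[mu]_(s in D) limn (series (h ^~ s)))%R.
Proof.
move=> mD mh iG G0 M0 cM hM.
have ih n : mu.-integrable D (EFin \o h n).
  apply: (@le_integrable _ _ _ _ _ mD _ (fun s => (M n)%:E * (G s)%:E)%E).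
  - exact/measurable_EFinP.
  - move=> s Ds; rewrite /= lee_fin normrM [`|M n|]ger0_norm// [`|G s|]ger0_norm ?G0//.
    exact: hM.
  - exact: integrableZl.
pose L := limn (series M).
have mS N : measurable_fun D (fun s => (series (h ^~ s) N)%:E).
  by have [/integrableP[]] := integrable_series N mD ih.
have hG s : D s -> cvgn (series (fun n => M n * G s)) /\
    limn (series (fun n => M n * G s)) = L * G s.
  move=> Ds; rewrite (_ : (fun n => M n * G s) = G s *: M); last first.
    by apply/funext => n; rewrite /= mulrC.
  by split; [exact: is_cvg_seriesZ|rewrite lim_seriesZ//; exact: mulrC].
have cS s : D s -> (series (h ^~ s) N)%:E @[N --> \oo] --> (limn (series (h ^~ s)))%:E.
  move=> Ds; apply: cvg_EFin; first exact: nearW.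
  by apply: (is_cvg_series_dominated (fun n => hM n s Ds)); exact: (hG _ Ds).1.
have mL : measurable_fun D (fun s => (limn (series (h ^~ s)))%:E).
  exact: emeasurable_fun_cvg mS cS.
have iLG : mu.-integrable D (fun s => (L * G s)%:E).
  under eq_fun do rewrite EFinM; exact: integrableZl.
have hLG s N : D s -> (`|(series (h ^~ s) N)%:E| <= (L * G s)%:E)%E.
  move=> Ds; rewrite lee_fin -(hG _ Ds).2.
  apply: (@le_trans _ _ (series (fun n => M n * G s) N)).
    by apply: (le_trans (ler_norm_sum _ _ _)); rewrite ler_sum// => n _; exact: hM.
  by apply: series_le_lim (hG _ Ds).1 => n; rewrite mulr_ge0 ?G0.
have [] := @dominated_convergence _ _ _ mu D mD
    (fun N s => (series (h ^~ s) N)%:E) (fun s => (limn (series (h ^~ s)))%:E)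
    (fun s => (L * G s)%:E) mS mL.
- exact/aeW/cS.
- exact: iLG.
- by apply: aeW => s N; exact: hLG.
move=> iL _ cI; split=> //.
have -> : series (fun n => \int[mu]_(s in D) h n s)%R =
    (fun N => fine (\int[mu]_(s in D) (series (h ^~ s) N)%:E)).
  by apply/funext => N; rewrite -(integrable_series N mD ih).2.
apply: fine_cvg; rewrite /Rintegral fineK//; exact: integrable_fin_num.
Qed.
End DominatedSeries.

(** * Truncated powers and the recursively defined summands of the series *)

Lemma nat_ind2 (P : nat -> Prop) :
  P 0%N -> P 1%N -> (forall n, P n -> P n.+1 -> P n.+2) -> forall n, P n.
Proof.
move=> P0 P1 IH n; suff : P n /\ P n.+1 by case.
by elim: n => [//|n [Pn Pn1]]; split=> //; exact: IH.
Qed.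

Section Terms.
Context {R : realType}.
Notation mu := (@lebesgue_measure R).

Lemma ppow_le (nu s t : R) : 0 <= nu -> s <= t -> ppow nu s <= ppow nu t.
Proof.
move=> nu0 st; have h x : 0 <= Num.max 0 x :> R by rewrite le_max lexx.
by apply: ge0_ler_powR; rewrite ?nnegrE ?h// ge_max h le_max st orbT.
Qed.

Lemma is_derive_ppow (nu s : R) : 0 < s ->
  is_derive s 1 (ppow nu) (nu * ppow (nu - 1) s).
Proof.
move=> s0; rewrite (ppow_gt0E _ s0).
apply: (near_eq_is_derive _ (is_derive1_powR nu s0)).
by near=> z; rewrite ppow_gt0E//; near: z; exact: lt_nbhsr.
Unshelve. all: by end_near. Qed.

Lemma is_derive_ppow_gt1 (nu s : R) : 1 < nu ->
  is_derive s 1 (ppow nu) (nu * ppow (nu - 1) s).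
Proof.
move=> nu1; case: (ltrgtP s 0) => [s0|s0|->]; last 2 first.
- exact: is_derive_ppow.
- have nu10 : 0 < nu - 1 by rewrite subr_gt0.
  rewrite ppow_le0E ?gt_eqF// mulr0.
  have lim : (fun h : R => h^-1 *: (ppow nu (h *: 1 + 0) - ppow nu 0)) @ 0^' --> (0 : R).
    apply/cvgr0Pnorm_le => e e0.
    near=> h.
    have hd : h < e `^ (nu - 1)^-1.
      by near: h; apply: nbhs_dnbhs; apply: lt_nbhsl; rewrite powR_gt0.
    rewrite [h *: 1]mulr1 addr0 [ppow nu 0]ppow_le0E ?gt_eqF//; last by lra.
    rewrite subr0; have [h0|h0] := leP h 0.
      by rewrite ppow_le0E// ?scaler0 ?normr0 ?ltW// gt_eqF//; lra.
    rewrite ppow_gt0E// [X in `|X|](_ : _ = h `^ (nu - 1)).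
      rewrite ger0_norm ?powR_ge0// [leRHS](_ : e = (e `^ (nu - 1)^-1) `^ (nu - 1)).
        by apply: ge0_ler_powR; rewrite ?nnegrE ?powR_ge0// ltW.
      by rewrite -powRrM mulVf ?gt_eqF// powRr1 ?ltW.
    by rewrite -(mulr_powRB1 (ltW h0)) ?(lt_trans ltr01 nu1)// -[LHS]/(h^-1 * _) mulKf ?gt_eqF.
  by split; [apply/cvg_ex; exists 0|apply: cvg_lim lim].
- rewrite ppow_le0E ?ltW// ?mulr0 ?gt_eqF ?subr_gt0//.
  apply: (near_eq_is_derive _ (is_derive_cst (0 : R) s 1)).
    near=> z; rewrite ppow_le0E//; last by rewrite gt_eqF//; lra.
    by apply: ltW; near: z; exact: lt_nbhsl.
Unshelve. all: by end_near. Qed.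

Lemma continuous_ppow1 : continuous (ppow (1 : R)).
Proof.
have -> : ppow 1 = (fun t : R => Num.max 0 t).
  by apply/funext => t; rewrite /ppow powRr1// le_max lexx.
move=> t; apply: continuous_max; [exact: cvg_cst|exact: cvg_id].
Qed.

Section Recursion.
Variables (e1 e2 : nat -> R) (q r tau : R).

(* [term n nu] applies to the delayed powers of exponent [nu] the n-th polynomial
   in the delay operator; the n-th summand of the solution is obtained for
   [nu = 1 + n alpha], its derivatives from lower exponents and the same n. *)
Fixpoint term (n : nat) (nu t : R) : R :=
  match n with
  | 0 => ppow nu t
  | n1.+1 => match n1 with
    | 0 => e1 0 * ppow nu t
    | n2.+1 => e1 n1 * term n1 nu t + e2 n2 * (q * term n2 nu t - r * term n2 nu (t - tau))
    end
  end.

Lemma termSS n nu t : term n.+2 nu t =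
  e1 n.+1 * term n.+1 nu t + e2 n * (q * term n nu t - r * term n nu (t - tau)).
Proof. by []. Qed.

(** The majorant of the recursion of [term]: absolute values replace [q] and [- r], and the delay is
    dropped. *)
Fixpoint coef (n : nat) : R :=
  match n with
  | 0 => 1
  | n1.+1 => match n1 with
    | 0 => e1 0
    | n2.+1 => e1 n1 * coef n1 + e2 n2 * ((`|q| + `|r|) * coef n2)
    end
  end.

Lemma coefSS n : coef n.+2 = e1 n.+1 * coef n.+1 + e2 n * ((`|q| + `|r|) * coef n).
Proof. by []. Qed.

Lemma term_le1 n nu t : (n <= 1)%N -> term n nu t = coef n * ppow nu t.
Proof. by case: n => [|[|//]] _ /=; rewrite ?mul1r. Qed.

Hypotheses (e1_ge0 : forall n, 0 <= e1 n) (e2_ge0 : forall n, 0 <= e2 n).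
Hypothesis tau_ge0 : 0 <= tau.

Lemma coef_ge0 n : 0 <= coef n.
Proof.
elim/nat_ind2: n => [||n IH1 IH2]; [exact: ler01|exact: e1_ge0|].
by rewrite coefSS addr_ge0 ?mulr_ge0 ?addr_ge0.
Qed.

(** For nonnegative exponents [ppow] is nondecreasing, so a shift by the delay can only decrease it
    and all delayed powers are bounded by the undelayed one. *)
Lemma term_norm_le n nu t : 0 <= nu -> `|term n nu t| <= coef n * ppow nu t.
Proof.
move=> nu0; elim/nat_ind2: n t => [||n IH1 IH2] t.
- by rewrite /= mul1r ger0_norm ?ppow_ge0.
- by rewrite /= ger0_norm ?mulr_ge0 ?ppow_ge0.
rewrite termSS coefSS mulrDl; apply: (le_trans (ler_normD _ _)).
apply: lerD; first by rewrite normrM ger0_norm// -mulrA ler_wpM2l.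
rewrite normrM ger0_norm// -!mulrA ler_wpM2l// mulrDl.
apply: (le_trans (ler_normB _ _)); rewrite !normrM lerD// ler_wpM2l//.
apply: (le_trans (IH1 _)); rewrite ler_wpM2l ?coef_ge0// ppow_le//.
by rewrite gerBl.
Qed.

Lemma term_le0 n nu t : 0 < nu -> t <= 0 -> term n nu t = 0.
Proof.
move=> nu0 t0; apply/eqP; rewrite -normr_le0.
by apply: (le_trans (term_norm_le n t (ltW nu0))); rewrite ppow_le0E ?mulr0// gt_eqF.
Qed.

(* A linear relation that holds between delayed powers of exponents nu and nu'
   is inherited by the terms, which are linear combinations of such powers. *)
Lemma term_linear_ind (nu nu' : R) (P : (R -> R) -> (R -> R) -> Prop) :
  (forall a f g, P f g -> P (fun s => a * f s) (fun s => a * g s)) ->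
  (forall f g f' g', P f g -> P f' g' -> P (fun s => f s + f' s) (fun s => g s + g' s)) ->
  (forall d, 0 <= d -> P (fun s => ppow nu (s - d)) (fun s => ppow nu' (s - d))) ->
  forall n, P (term n nu) (term n nu').
Proof.
move=> PZ PD P0 n.
(* The claim is generalized to all shifts, since the recursion turns a shift [d] into [d + tau]. *)
suff H d : 0 <= d -> P (fun s => term n nu (s - d)) (fun s => term n nu' (s - d)).
  have := H 0 (lexx _).
  by under eq_fun do rewrite subr0; under [X in P _ X]eq_fun do rewrite subr0.
elim/nat_ind2: n d => [||n IH1 IH2] d d0; first exact: P0.
  by apply: PZ; exact: P0.
have e m : (fun s => term n.+2 m (s - d)) = (fun s => e1 n.+1 * term n.+1 m (s - d) +
     e2 n * (q * term n m (s - d) + (- r) * term n m (s - (d + tau)))).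
  by apply/funext => s; rewrite termSS opprD addrA mulNr.
rewrite !e; apply: (PD _ _ _ _ (PZ _ _ _ (IH2 _ d0)) (PZ _ _ _ _)).
by apply: (PD _ _ _ _ (PZ _ _ _ (IH1 _ d0)) (PZ _ _ _ (IH1 _ _))); exact: addr_ge0.
Qed.

Lemma is_derive_term n (nu s : R) : 1 < nu ->
  is_derive s 1 (term n nu) (nu * term n (nu - 1) s).
Proof.
move=> nu1; pose P (f g : R -> R) := forall s : R, is_derive s 1 f (nu * g s).
suff H : P (term n nu) (term n (nu - 1)) by exact: H.
apply: term_linear_ind => {s} [a f g fg s|f g f' g' fg fg' s|d d0 s].
- have := fg s => ?.
  have -> : nu * (a * g s) = a *: (nu * g s) by rewrite [RHS]mulrCA.
  exact: (@is_deriveZ _ _ _ f a).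
- rewrite mulrDr; have := fg s; have := fg' s => *.
  exact: is_deriveD.
- have := is_derive_ppow_gt1 (s - d) nu1 => h.
  have h' : is_derive s 1 (fun z : R => z - d) 1.
    by rewrite -[X in is_derive _ _ _ X]addr0 -oppr0; exact: is_deriveB.
  have := @is_derive1_comp _ (ppow nu) (fun z => z - d) s _ _ h h'.
  by rewrite mulr1.
Qed.

(** The first two terms contain no delayed power; at positive times they are smooth, whatever the
    exponent. *)
Lemma is_derive_term_le1 n (nu s : R) : (n <= 1)%N -> 0 < s ->
  is_derive s 1 (term n nu) (nu * term n (nu - 1) s).
Proof.
move=> n1 s0; rewrite term_le1// mulrCA.
have -> : term n nu = (fun t => coef n *: ppow nu t).
  by apply/funext => t; rewrite term_le1.
by have := is_derive_ppow nu s0 => ?; exact: is_deriveZ.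
Qed.

Lemma measurable_term n nu : measurable_fun setT (term n nu).
Proof.
pose P (f _ : R -> R) := measurable_fun setT f.
suff H : P (term n nu) (term n nu) by exact: H.
apply: term_linear_ind.
- by move=> a f g mf; exact: measurable_funM.
- by move=> f g f' g' mf mf'; exact: measurable_funD.
- by move=> d _; exact: measurable_ppow.
Qed.

(** The Beta factor depends on the exponent and not on the delay, hence is common to all powers in a
    term. For [n <= 1] there is no delay, and nonpositive exponents are admissible. *)
Lemma abel_term (b nu t : R) n : 0 <= b < 1 -> -1 < nu -> 0 < nu \/ (n <= 1)%N ->
  0 < t ->
  mu.-integrable `]0%R, t[ (fun s => ((t - s) `^ (- b) * term n nu s)%:E) /\
  \int[mu]_(s in `]0%R, t[) ((t - s) `^ (- b) * term n nu s) =
    beta b nu * term n (nu + 1 - b) t.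
Proof.
move=> b01 nu1 nun t0.
pose P (f g : R -> R) :=
  mu.-integrable `]0%R, t[ (fun s => ((t - s) `^ (- b) * f s)%:E) /\
  \int[mu]_(s in `]0%R, t[) ((t - s) `^ (- b) * f s) = beta b nu * g t.
have PZ a f g : P f g -> P (fun s => a * f s) (fun s => a * g s).
  move=> [fi fE]; split.
    have -> : (fun s => ((t - s) `^ (- b) * (a * f s))%:E) =
      (fun s => (a%:E * ((t - s) `^ (- b) * f s)%:E)%E).
      by apply/funext => s; rewrite mulrCA EFinM.
    exact: integrableZl.
  by under eq_Rintegral do rewrite mulrCA; rewrite RintegralZl// fE mulrCA.
have PD f g f' g' : P f g -> P f' g' -> P (fun s => f s + f' s) (fun s => g s + g' s).
  move=> [fi fE] [fi' fE']; split.
    have -> : (fun s => ((t - s) `^ (- b) * (f s + f' s))%:E) =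
      (fun s => (((t - s) `^ (- b) * f s)%:E + ((t - s) `^ (- b) * f' s)%:E)%E).
      by apply/funext => s; rewrite mulrDr EFinD.
    exact: integrableD.
  by under eq_Rintegral do rewrite mulrDr; rewrite RintegralD// fE fE' mulrDr.
have P0 d : 0 <= d -> 0 < nu \/ d = 0 ->
    P (fun s => ppow nu (s - d)) (fun s => ppow (nu + 1 - b) (s - d)).
  move=> d0 nud; have E := abel_ppow b01 nu1 d0 t0 nud; split; last by rewrite /Rintegral E.
  apply/integrableP; split.
    apply/measurable_EFinP; apply: measurable_funM; last exact: measurable_ppow.
    apply: measurable_funTS; apply: (measurableT_comp (measurable_powR _)).
    exact: measurable_funB.
  under eq_integral do rewrite gee0_abs ?lee_fin ?mulr_ge0 ?powR_ge0 ?ppow_ge0//.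
  by rewrite E ltry.
case: nun => [nu0|n1].
  by apply: (@term_linear_ind nu (nu + 1 - b) P) => // d d0; apply: P0 => //; left.
have e m : term n m = (fun s => coef n * ppow m (s - 0)).
  by apply/funext => s; rewrite term_le1// subr0.
by rewrite -/(P _ _) !e; apply: PZ; apply: P0 => //; right.
Qed.

(** Up to a positive factor, the term of raised exponent is the fractional integral of order
    [delta], whose kernel is nonnegative; this is [abel_term] with [b = 1 - delta]. *)
Lemma term_raise_ge0 n nu delta : 0 < delta <= 1 -> 0 <= nu -> 0 < nu \/ (n <= 1)%N ->
  (forall t, 0 <= term n nu t) -> forall t, 0 <= term n (nu + delta) t.
Proof.
move=> /andP[d0 d1] nu0 nun T0 t.
have [t0|t0] := leP t 0; first by rewrite term_le0// ltr_wpDl.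
have b01 : 0 <= 1 - delta < 1 by apply/andP; split; lra.
have nu1 : -1 < nu by lra.
have [_] := abel_term b01 nu1 nun t0.
rewrite (_ : nu + 1 - (1 - delta) = nu + delta); last by ring.
move=> E; rewrite -(pmulr_rge0 _ (beta_gt0 b01 nu1)) -E.
by apply: Rintegral_ge0 => s _; rewrite mulr_ge0 ?powR_ge0.
Qed.

End Recursion.
End Terms.

(** * Nonnegativity of the summands *)

Section TermSigns.
Context {R : realType}.
Variables (e1 e2 : nat -> R) (q r tau alpha : R).
Hypotheses (e1_ge0 : forall n, 0 <= e1 n) (e2_ge0 : forall n, 0 <= e2 n).
Hypothesis tau_ge0 : 0 <= tau.
Hypotheses (alpha_gt : 1 < 2 * alpha) (alpha_lt : alpha < 1) (rq : `|r| <= q).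

Local Notation T := (term e1 e2 q r tau).

Lemma term_nondecreasing n nu s t : 1 < nu -> (forall t, 0 <= T n (nu - 1) t) ->
  s <= t -> T n nu s <= T n nu t.
Proof.
move=> nu1 T0 st.
have dT x := is_derive_term e1 e2 q r tau_ge0 n x nu1.
have [|c _ E] := @MVT_segment _ (T n nu) (fun x => nu * T n (nu - 1) x) s t st
    (fun x _ => dT x).
  by apply: derivable_within_continuous => x _; have [] := dT x.
by rewrite -subr_ge0 E !mulr_ge0 ?subr_ge0// (le_trans ler01)// ltW.
Qed.

(** Both earlier terms are raised to the exponent [n.+2%:R * alpha]. There the n-th one is also
    nondecreasing in time, so its delayed value is the smaller one and [|r| <= q] makes the bracket
    of the recursion nonnegative. *)
Lemma term_diag_ge0 n t : 0 <= T n (n%:R * alpha) t.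
Proof.
have [ag al] := (alpha_gt, alpha_lt).
elim/nat_ind2: n t => [||n IH1 IH2] t; first exact: ppow_ge0.
  by rewrite /= mulr_ge0 ?ppow_ge0.
have n0 : 0 <= n%:R * alpha by rewrite mulr_ge0//; lra.
have cond : 0 < n%:R * alpha \/ (n <= 1)%N.
  by case: n {IH1 IH2 n0} => [|n]; [right|left; rewrite mulr_gt0//; lra].
(* A raise is limited to 1, so [2 * alpha] is split in two. Ending with a raise by exactly 1 makes
   the derivative a multiple of the intermediate term, which yields monotonicity. *)
have E2 : n.+2%:R * alpha = n%:R * alpha + (2 * alpha - 1) + 1.
  by rewrite -addn2 natrD; ring.
have T1 x : 0 <= T n (n%:R * alpha + (2 * alpha - 1)) x.
  by apply: term_raise_ge0 => //; apply/andP; split; lra.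
have T2 x : 0 <= T n (n.+2%:R * alpha) x.
  by rewrite E2; apply: term_raise_ge0; rewrite ?ltr01 ?lexx//; [lra|left; lra].
have mono : T n (n.+2%:R * alpha) (t - tau) <= T n (n.+2%:R * alpha) t.
  apply: term_nondecreasing; rewrite ?gerBl// E2; first by lra.
  by rewrite addrK.
rewrite termSS addr_ge0 ?mulr_ge0//.
  have -> : n.+2%:R * alpha = n.+1%:R * alpha + alpha by rewrite -(natr1 n.+1); ring.
  apply: term_raise_ge0 => //; first by apply/andP; split; lra.
  - by rewrite mulr_ge0//; lra.
  - by left; rewrite mulr_gt0//; lra.
rewrite subr_ge0; apply: (@le_trans _ _ (`|r| * T n (n.+2%:R * alpha) (t - tau))).
  by rewrite ler_wpM2r// ler_norm.
by apply: ler_pM.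
Qed.

Lemma term_diag1_ge0 n t : 0 <= T n (1 + n%:R * alpha) t.
Proof.
have [ag al] := (alpha_gt, alpha_lt).
rewrite addrC; apply: term_raise_ge0; rewrite ?ltr01 ?lexx//.
- by rewrite mulr_ge0//; lra.
- by case: n => [|n]; [right|left; rewrite mulr_gt0//; lra].
- exact: term_diag_ge0.
Qed.

End TermSigns.

(** * Superexponential decay of the coefficients *)

Section CoefGrowth.
Context {R : realType}.
Variables (e1 e2 : nat -> R) (q r : R).
Hypotheses (e1_ge0 : forall n, 0 <= e1 n) (e2_ge0 : forall n, 0 <= e2 n).
Hypotheses (e1_cvg0 : e1 @ \oo --> 0) (e2_cvg0 : e2 @ \oo --> 0).
Local Notation coef := (coef e1 e2 q r).

(** Once [e1] and [e2] are below suitable thresholds, each of the two summands of the recursion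
    contributes at most half of [C * rho ^+ n.+2]; the constant takes care of the finitely many
    earlier indices. *)
Lemma coef_geometric (rho : R) : 0 < rho -> exists C : R, forall n, coef n <= C * rho ^+ n.
Proof.
move=> rho0; pose Q := `|q| + `|r|.
have Q1 : 0 < Q + 1 by rewrite ltr_wpDl ?addr_ge0.
have [N [HN1 HN2]] : exists N, (forall n, (N <= n)%N -> e1 n <= rho / 2) /\
    (forall n, (N <= n)%N -> e2 n <= rho ^+ 2 / 2 / (Q + 1)).
  have [//|N1 _ H1] := @cvgr0_norm_le _ _ _ _ _ _ e1_cvg0 (rho / 2).
    by rewrite divr_gt0.
  have [//|N2 _ H2] := @cvgr0_norm_le _ _ _ _ _ _ e2_cvg0 (rho ^+ 2 / 2 / (Q + 1)).
    by rewrite !divr_gt0// exprn_gt0.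
  exists (maxn N1 N2); split => n; rewrite geq_max => /andP[n1 n2].
    by apply: le_trans (H1 _ n1); rewrite ger0_norm.
  by apply: le_trans (H2 _ n2); rewrite ger0_norm.
have c0 := coef_ge0 q r e1_ge0 e2_ge0.
(* A sum of nonnegative ratios dominates each of them; it serves as a maximum over the initial
   indices. *)
pose C := \sum_(k < N.+2) coef k / rho ^+ k.
have C0 : 0 <= C by apply: sumr_ge0 => k _; rewrite divr_ge0 ?exprn_ge0 ?(ltW rho0) ?c0.
exists C => n.
have small n' : (n' < N.+2)%N -> coef n' <= C * rho ^+ n'.
  move=> nN; rewrite -ler_pdivrMr ?exprn_gt0// /C (bigD1 (Ordinal nN))//= lerDl.
  by apply: sumr_ge0 => k _; rewrite divr_ge0 ?exprn_ge0 ?(ltW rho0) ?c0.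
elim/nat_ind2: n => [||n IH1 IH2]; [exact: small|exact: small|].
have [nN|Nn] := ltnP n N; first by apply: small; rewrite !ltnS.
rewrite coefSS.
have h1 : e1 n.+1 * coef n.+1 <= rho / 2 * (C * rho ^+ n.+1).
  by apply: ler_pM => //; apply: HN1; exact: ltnW.
have h2 : e2 n * (Q * coef n) <= rho ^+ 2 / 2 / (Q + 1) * ((Q + 1) * (C * rho ^+ n)).
  apply: ler_pM => //; [by rewrite mulr_ge0 ?addr_ge0|exact: HN2|].
  by apply: ler_pM; rewrite ?addr_ge0 ?lerDl.
apply: (le_trans (lerD h1 h2)).
rewrite [leLHS](_ : _ = C * rho ^+ n.+2)// !exprS.
by field; rewrite gt_eqF.
Qed.

Lemma cvg_series_coef (W : R) : 0 < W ->
  cvgn (series (fun n => n.+1%:R ^+ 2 * coef n * W ^+ n)).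
Proof.
(* With this ratio and [n.+1%:R ^+ 2 <= 4 ^+ n], the series is dominated by a geometric one of ratio
   4 / 8. *)
move=> W0; have W8 : 0 < (8 * W)^-1 by rewrite invr_gt0 mulr_gt0.
have [C HC] := coef_geometric W8.
have c0 := coef_ge0 q r e1_ge0 e2_ge0.
have C0 : 0 <= C by have := HC 0%N; rewrite expr0 mulr1; apply: le_trans.
apply: (@series_le_cvg _ _ (geometric C 2^-1)).
- by move=> n; rewrite !mulr_ge0 ?exprn_ge0// ltW.
- by move=> n; rewrite /= mulr_ge0 ?exprn_ge0.
- move=> n /=.
  have n4 : (n.+1%:R ^+ 2 : R) <= 4 ^+ n.
    rewrite (_ : 4 = 2 ^+ 2); last by rewrite expr2; ring.
    rewrite -exprM mulnC exprM lerXn2r ?nnegrE ?exprn_ge0//.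
    by rewrite -natrX ler_nat ltn_expl.
  apply: (@le_trans _ _ (4 ^+ n * (C * ((8 * W)^-1) ^+ n) * W ^+ n)).
    apply: ler_wpM2r; first by rewrite exprn_ge0 ?ltW.
    by apply: ler_pM => //; exact: exprn_ge0.
  rewrite -mulrA -mulrA -exprMn mulrCA -exprMn.
  rewrite (_ : 4 * ((8 * W)^-1 * W) = 2^-1)//.
  by field; rewrite gt_eqF.
by apply: is_cvg_geometric_series; rewrite ger0_norm ?invr_ge0//; lra.
Qed.

End CoefGrowth.

(** * Positivity of the Gamma factors and decay of the Beta factors *)

Section Constants.
Context {R : realType}.
Notation mu := (@lebesgue_measure R).

(** The power dominates the integrand before 1, the density of the exponential law from 1 on. *)
Lemma integrable_Gamma (z : R) : 0 < z <= 1 ->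
  mu.-integrable `]0%R, +oo[ (fun t => (t `^ (z - 1) * expR (- t))%:E).
Proof.
move=> /andP[z0 z1].
pose G := (fun t : R => t `^ (z - 1)) \_ `]0%R, 1%R[.
have iG : mu.-integrable `]0%R, +oo[ (EFin \o G).
  apply: (@integrableS _ _ _ mu setT) => //; rewrite /G -restrict_EFin.
  apply/integrable_restrict => //; rewrite setTI.
  by apply: integrable_powR01; lra.
have iE : mu.-integrable `]0%R, +oo[ (EFin \o exponential_pdf 1).
  by apply: (@integrableS _ _ _ mu setT) => //; exact: integrable_exponential_pdf.
have iGE : mu.-integrable `]0%R, +oo[ (fun t => (G t + exponential_pdf 1 t)%:E).
  exact: (integrableD _ iG iE).
have G0 t : 0 <= G t by rewrite /G; apply: restrict_ge0 => x _; exact: powR_ge0.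
apply: (@le_integrable _ _ _ mu _ _ _ (fun t => (G t + exponential_pdf 1 t)%:E)) => //.
- apply/measurable_EFinP; apply: measurable_funM; first exact: measurable_funTS.
  apply: measurable_funTS; exact: measurableT_comp.
- move=> t /=; rewrite in_itv/= andbT => t0.
  have E0 := exponential_pdf_ge0 ler01 t.
  rewrite lee_fin !ger0_norm ?mulr_ge0 ?powR_ge0 ?expR_ge0 ?addr_ge0//.
  rewrite (exponential_pdfE _ (ltW t0)) mul1r mulN1r.
  have e0 := expR_gt0 (- t).
  have [t1|t1] := ltP t 1.
    rewrite /G patchE ifT; last by rewrite inE/= in_itv/= t0.
    rewrite -[leLHS]addr0; apply: lerD => //.
    rewrite ler_piMr ?powR_ge0// -expR0 ler_expR; lra.
  rewrite -[leLHS]add0r; apply: lerD => //.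
  rewrite (ler_piMl (ltW e0))// -[leRHS](powRr0 t); apply: ler_powR => //; lra.
Qed.

Lemma Gamma_ge0 (z : R) : 0 <= Gamma z.
Proof. by apply: Rintegral_ge0 => t _; rewrite mulr_ge0 ?powR_ge0 ?expR_ge0. Qed.

(** An infinite integral would be read as 0, so integrability is essential. Then the part over []0,
    1[], where the integrand is at least [expR (-1)], bounds the value from below. *)
Lemma Gamma_gt0 (z : R) : 0 < z <= 1 -> 0 < Gamma z.
Proof.
move=> z01; have iG := integrable_Gamma z01; case/andP: z01 => z0 z1.
apply: (@lt_le_trans _ _ (expR (-1))); first exact: expR_gt0.
have fG : (\int[mu]_(t in `]0%R, +oo[) (t `^ (z - 1) * expR (- t))%:E)%E \is a fin_num.
  exact: integrable_fin_num.
rewrite -lee_fin /Gamma /Rintegral fineK//.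
apply: (@le_trans _ _ (\int[mu]_(t in `]0%R, 1%R[) (t `^ (z - 1) * expR (- t))%:E)%E).
  apply: (@le_trans _ _ (\int[mu]_(t in `]0%R, 1%R[) (expR (-1))%:E)%E).
    by rewrite integral_cst//= lebesgue_measure_itv/= lte_fin ltr01 oppr0 adde0 mule1.
  apply: ge0_le_integral => //.
  - by case/integrableP: iG => m _; apply: measurable_funS m => // t /=; rewrite !in_itv/= andbT => /andP[].
  - move=> t /=; rewrite in_itv/= => /andP[t0 t1]; rewrite lee_fin.
    apply: (@le_trans _ _ (expR (- t))); first by rewrite ler_expR; lra.
    rewrite ler_peMl ?expR_ge0// -[leLHS](powRr0 t); apply: ger_powR; last lra.
    by rewrite t0 ltW.
apply: ge0_subset_integral => //.
- by case/integrableP: iG.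
- by move=> t _; rewrite lee_fin mulr_ge0 ?powR_ge0 ?expR_ge0.
- by move=> t /=; rewrite !in_itv/= andbT => /andP[].
Qed.

(** Dominated convergence with majorant [(1 - u)]^ (- b)[: the powers](u [^ alpha) ^+ n] tend to 0
    for [u] below 1. *)
Lemma beta_cvg0 (b alpha : R) : 0 <= b < 1 -> 0 < alpha ->
  beta b (n%:R * alpha) @[n --> \oo] --> 0.
Proof.
move=> b01 a0; pose I01 := `](0 : R), (1 : R)[%classic.
have mI : measurable I01 by exact: measurable_itv.
pose f_ n u := ((1 - u) `^ (- b) * u `^ (n%:R * alpha))%:E.
have mf n : measurable_fun I01 (f_ n).
  have := @measurable_abel R b (n%:R * alpha) 1 0 I01.
  by apply: eq_measurable_fun => u _; rewrite subr0.
have i1 : mu.-integrable I01 (fun u => ((1 - u) `^ (- b))%:E).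
  by apply: integrable_onem_powR01; case/andP: b01 => _; rewrite ltrN2.
have [] := @dominated_convergence _ _ _ mu I01 mI f_ (cst 0%E) _ mf _ _ i1 _.
- exact: measurable_cst.
- apply: aeW => u; rewrite /I01/= in_itv/= => /andP[u0 u1].
  apply: cvg_EFin; first exact: nearW.
  rewrite -[X in _ --> X](mulr0 ((1 - u) `^ (- b))).
  apply: cvgMl_tmp; rewrite [X in X @ _](_ : _ = (fun n => (u `^ alpha) ^+ n)).
    apply: cvg_expr; rewrite ger0_norm ?powR_ge0// /powR gt_eqF// -expR0 ltr_expR.
    by rewrite pmulr_rlt0// ln_lt0// u0.
  by apply/funext => n; rewrite mulrC powRrM powR_mulrn ?powR_ge0.
- apply: aeW => u n; rewrite /I01/= in_itv/= => /andP[u0 u1].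
  rewrite lee_fin ger0_norm ?mulr_ge0 ?powR_ge0// ler_piMr ?powR_ge0//.
  rewrite -[leRHS](powRr0 u); apply: ger_powR; first by rewrite u0 ltW.
  by rewrite mulr_ge0// ltW.
move=> _ _; rewrite integral0 => h.
exact: fine_cvg h.
Qed.

End Constants.

(** * The series, its termwise derivatives and its behaviour at 0 *)

Section SolutionSeries.
Context {R : realType}.
Notation mu := (@lebesgue_measure R).
Variables (e1 e2 : nat -> R) (q r tau alpha : R).
Hypotheses (e1_ge0 : forall n, 0 <= e1 n) (e2_ge0 : forall n, 0 <= e2 n).
Hypotheses (e1_cvg0 : e1 @ \oo --> 0) (e2_cvg0 : e2 @ \oo --> 0).
Hypothesis tau_ge0 : 0 <= tau.
Hypotheses (alpha_gt : 1 < 2 * alpha) (alpha_lt : alpha < 1).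

Local Notation T := (term e1 e2 q r tau).

Definition maj (W : R) (n : nat) : R := n.+1%:R ^+ 2 * coef e1 e2 q r n * W ^+ n.

Definition sol (t : R) : R := limn (series (fun n => T n (1 + n%:R * alpha) t)).

Definition sol1 (t : R) : R :=
  limn (series (fun n => (1 + n%:R * alpha) * T n (n%:R * alpha) t)).

Definition sol2 (t : R) : R :=
  limn (series (fun n => (1 + n%:R * alpha) * (n%:R * alpha) * T n (n%:R * alpha - 1) t)).

Let alpha_gt0 : 0 < alpha.
Proof. by have ag := alpha_gt; lra. Qed.

Let nalpha_ge0 n : 0 <= n%:R * alpha.
Proof. by rewrite mulr_ge0// ltW. Qed.

Let nalpha_le n : n%:R * alpha <= n%:R.
Proof. by rewrite ler_piMr// ltW. Qed.

Lemma maj_ge0 W n : 0 <= W -> 0 <= maj W n.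
Proof. by move=> W0; rewrite !mulr_ge0 ?exprn_ge0// coef_ge0. Qed.

Lemma cvg_series_maj W : 0 < W -> cvgn (series (maj W)).
Proof. by move=> W0; exact: cvg_series_coef. Qed.

Lemma powR_nalpha_le n (s H : R) : 0 < s <= H -> s `^ (n%:R * alpha) <= (H `^ alpha) ^+ n.
Proof.
move=> /andP[s0 sH]; rewrite -powR_mulrn ?powR_ge0// -powRrM [alpha * _]mulrC.
by apply: ge0_ler_powR => //; rewrite nnegrE ltW// (lt_le_trans s0).
Qed.

Let coef0 n : 0 <= coef e1 e2 q r n.
Proof. exact: coef_ge0. Qed.

Let sqr1 n : 1 <= (n.+1%:R : R) ^+ 2.
Proof. by rewrite exprn_ege1// ler1n. Qed.

Let le_n1 n : 1 + n%:R * alpha <= n.+1%:R.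
Proof. by rewrite -natr1 addrC lerD2r nalpha_le. Qed.

Lemma sol_term_bound n (t H : R) : 0 < H -> t <= H ->
  `|T n (1 + n%:R * alpha) t| <= H * maj (H `^ alpha) n.
Proof.
move=> H0 tH; have p0 : 0 <= 1 + n%:R * alpha by rewrite addr_ge0.
apply: (le_trans (term_norm_le q r e1_ge0 e2_ge0 tau_ge0 n t p0)).
apply: (@le_trans _ _ (coef e1 e2 q r n * ppow (1 + n%:R * alpha) H)).
  by rewrite ler_wpM2l// ppow_le.
rewrite ppow_gt0E// gt0_powRD// (powRr1 (ltW H0)) mulrCA ler_pM2l// /maj -mulrA.
apply: (@le_trans _ _ (coef e1 e2 q r n * (H `^ alpha) ^+ n)).
  by rewrite ler_wpM2l// powR_nalpha_le// H0 lexx.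
by rewrite ler_peMl// mulr_ge0// exprn_ge0 ?powR_ge0.
Qed.

Lemma sol1_term_bound n (t H : R) : 0 < t <= H ->
  `|(1 + n%:R * alpha) * T n (n%:R * alpha) t| <= maj (H `^ alpha) n.
Proof.
move=> /[dup] tH /andP[t0 _]; rewrite normrM ger0_norm ?addr_ge0// /maj -mulrA.
apply: ler_pM; rewrite ?addr_ge0//.
  by apply: (le_trans (le_n1 n)); rewrite expr2 ler_peMl// ler1n.
apply: (le_trans (term_norm_le q r e1_ge0 e2_ge0 tau_ge0 n t (nalpha_ge0 n))).
by rewrite ler_wpM2l// ppow_gt0E// powR_nalpha_le.
Qed.

(** The second derivative is singular at 0 like [t]^ (alpha - 1)[, because of the summand of index
    1. This power is split off from every summand, at the cost of one factor]H [^ alpha]. *)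
Lemma sol2_term_bound n (t H : R) : 0 < t <= H ->
  `|(1 + n%:R * alpha) * (n%:R * alpha) * T n (n%:R * alpha - 1) t| <=
  maj (H `^ alpha) n * ((H `^ alpha)^-1 * t `^ (alpha - 1)).
Proof.
move=> /[dup] tH /andP[t0 tleH]; have H0 : 0 < H by exact: lt_le_trans tleH.
have W0 : 0 < H `^ alpha by exact: powR_gt0.
(* The factor [n%:R * alpha] removes the summand of index 0, whose exponent -1 would not be
   integrable. *)
case: n => [|n].
  rewrite !mul0r mulr0 mul0r normr0 mulr_ge0 ?maj_ge0 ?(ltW W0)//.
  by rewrite mulr_ge0 ?powR_ge0// invr_ge0 ltW.
have hT : `|T n.+1 (n.+1%:R * alpha - 1) t| <=
    coef e1 e2 q r n.+1 * t `^ (n.+1%:R * alpha - 1).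
  (* At index 1 the exponent [alpha - 1] is negative and the explicit form of the term is used; from
     index 2 on the exponent is positive since [1 < 2 * alpha]. *)
  rewrite -(ppow_gt0E _ t0); case: n => [|n].
    by rewrite term_le1// ger0_norm// mulr_ge0// ppow_ge0.
  apply: term_norm_le => //; have := nalpha_ge0 n; have ag := alpha_gt.
  rewrite -(natr1 n.+1) -(natr1 n) => ?; lra.
have hp : t `^ (n.+1%:R * alpha - 1) <= (H `^ alpha) ^+ n.+1 * ((H `^ alpha)^-1 * t `^ (alpha - 1)).
  rewrite mulrA exprSr mulfK ?gt_eqF//.
  rewrite (_ : n.+1%:R * alpha - 1 = n%:R * alpha + (alpha - 1)); last first.
    by rewrite -(natr1 n); ring.
  by rewrite [leLHS]gt0_powRD// ler_wpM2r ?powR_ge0// powR_nalpha_le.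
rewrite normrM /maj -2!mulrA; apply: ler_pM => //.
  rewrite normrM !ger0_norm ?addr_ge0// expr2; apply: ler_pM; rewrite ?addr_ge0//.
  by apply: (le_trans (nalpha_le _)); rewrite ler_nat.
apply: (le_trans hT); exact: ler_wpM2l.
Qed.

Lemma is_cvg_sol t : cvgn (series (fun n => T n (1 + n%:R * alpha) t)).
Proof.
pose H := `|t| + 1; have H0 : 0 < H by rewrite ltr_wpDl.
apply: (@is_cvg_series_dominated _ _ (H *: maj (H `^ alpha))) => [n|].
  by apply: sol_term_bound => //; rewrite (le_trans (ler_norm t))// lerDl.
by apply: is_cvg_seriesZ; apply: cvg_series_maj; exact: powR_gt0.
Qed.

Lemma is_cvg_sol1 t : 0 < t ->
  cvgn (series (fun n => (1 + n%:R * alpha) * T n (n%:R * alpha) t)).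
Proof.
move=> t0; apply: (@is_cvg_series_dominated _ _ (maj (t `^ alpha))) => [n|].
  by apply: sol1_term_bound; rewrite t0 lexx.
by apply: cvg_series_maj; exact: powR_gt0.
Qed.

Lemma is_derive_sol (s : R) : 0 < s -> is_derive s 1 sol (sol1 s).
Proof.
move=> s0; have h : 0 < s < s + 1 by rewrite s0/= ltrDl ltr01.
apply: (@is_derive_series _ (fun n => T n (1 + n%:R * alpha))
  (fun n t => (1 + n%:R * alpha) * T n (n%:R * alpha) t) (maj ((s + 1) `^ alpha)) _ _ _ h).
- by apply: cvg_series_maj; rewrite powR_gt0// addr_gt0.
- move=> n t /andP[t0 _].
  have -> : (1 + n%:R * alpha) * T n (n%:R * alpha) t =
    (1 + n%:R * alpha) * T n (1 + n%:R * alpha - 1) t by rewrite addrAC subrr add0r.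
  case: n => [|n]; first exact: is_derive_term_le1.
  by apply: is_derive_term => //; rewrite ltrDl mulr_gt0.
- by move=> n t /andP[t0 ts]; apply: sol1_term_bound; rewrite t0 ltW.
- by move=> t _; exact: is_cvg_sol.
Qed.

Lemma is_derive_sol1 (s : R) : 0 < s -> is_derive s 1 sol1 (sol2 s).
Proof.
(* The left end [s / 2] stays away from 0, where the majorant of the second derivative blows up. *)
move=> s0; have h : s / 2 < s < s + 1 by rewrite ltr_pdivrMr// ltrDl ltr01 andbT; lra.
have s20 : 0 < s / 2 by rewrite divr_gt0.
pose W := (s + 1) `^ alpha; have W0 : 0 < W by rewrite powR_gt0// addr_gt0.
apply: (@is_derive_series _ (fun n t => (1 + n%:R * alpha) * T n (n%:R * alpha) t)
  (fun n t => (1 + n%:R * alpha) * (n%:R * alpha) * T n (n%:R * alpha - 1) t)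
  ((W^-1 * (s / 2) `^ (alpha - 1)) *: maj W) _ _ _ h).
- by apply: is_cvg_seriesZ; exact: cvg_series_maj.
- move=> n t /andP[/(lt_trans s20) t0 _].
  suff d : is_derive t 1 (T n (n%:R * alpha)) (n%:R * alpha * T n (n%:R * alpha - 1) t).
    by rewrite -mulrA; exact: (@is_deriveZ _ _ _ (T n (n%:R * alpha)) (1 + n%:R * alpha)).
  have [n1|n1] := leqP n 1; first exact: is_derive_term_le1.
  apply: is_derive_term => //; apply: (lt_le_trans alpha_gt).
  by rewrite ler_pM2r// ler_nat.
- move=> n t /andP[st ts]; have t0 : 0 < t by exact: lt_trans st.
  have := @sol2_term_bound n t (s + 1); rewrite t0 ltW// => /(_ isT) /le_trans; apply.
  rewrite [leRHS]mulrC; apply: ler_wpM2l; first by rewrite maj_ge0// ltW.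
  rewrite ler_wpM2l ?invr_ge0 ?(ltW W0)//.
  rewrite -[alpha - 1]opprB !powRN lef_pV2 ?posrE ?powR_gt0//.
  by apply: ge0_ler_powR; rewrite ?nnegrE ?subr_ge0 ?ltW.
- by move=> t /andP[/(lt_trans s20) t0 _]; exact: is_cvg_sol1.
Qed.

Lemma sol_le0 t : t <= 0 -> sol t = 0.
Proof.
move=> t0; apply: cvg_lim => //.
have -> : (fun n => T n (1 + n%:R * alpha) t) = cst 0.
  by apply/funext => n; rewrite term_le0// ltr_pwDl.
have -> : series (cst (0 : R)) = cst 0 by apply/funext => n; rewrite /series/= big1.
exact: cvg_cst.
Qed.

(** Differentiability is available at positive times only, so continuity across 0 is obtained
    directly from Tannery's theorem. *)
Lemma continuous_sol : continuous sol.
Proof.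
move=> s; pose H := `|s| + 1; have H0 : 0 < H by rewrite ltr_wpDl.
apply: (@cvg_series_dominated _ _ (nbhs s) _ (fun n t => T n (1 + n%:R * alpha) t) _
  (H *: maj (H `^ alpha))).
- by apply: is_cvg_seriesZ; apply: cvg_series_maj; exact: powR_gt0.
- case=> [|n]; first by rewrite mul0r addr0; exact: continuous_ppow1.
  have := @is_derive_term R e1 e2 q r tau tau_ge0 n.+1 (1 + n.+1%:R * alpha) s.
  rewrite ltrDl mulr_gt0// => /(_ isT) d.
  by apply/differentiable_continuous/derivable1_diffP; exact: ex_derive.
- near=> t => n; apply: sol_term_bound => //; apply: ltW; near: t.
  apply: lt_nbhsl; rewrite /H (le_lt_trans (ler_norm s))// ltrDl//.
Unshelve. all: by end_near. Qed.

(** The summand of index 0 is the identity on positive times; all others have exponent above 1,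
    hence derivative 0 at 0. The bound [maj] at radius 1 permits the termwise limit. *)
Lemma sol_right_derivative : (h^-1 * (sol h - sol 0)) @[h --> 0^'+] --> (1 : R).
Proof.
have Tle0 n nu t : 0 < nu -> t <= 0 -> T n nu t = 0 by exact: term_le0.
rewrite (sol_le0 (lexx 0)); under eq_fun do rewrite subr0.
pose u n h := h^-1 * T n (1 + n%:R * alpha) h.
have l : limn (series (fun n => ((n == 0)%N%:R : R))) = 1.
  apply: cvg_lim => //; rewrite -(cvg_shiftn 1).
  rewrite [X in X @ _](_ : _ = cst (1 : R)); first exact: cvg_cst.
  apply/funext => n; rewrite /series/= addn1 big_nat_recl//= big1 ?addr0//.
rewrite -l.
have : limn (series (u ^~ h)) @[h --> 0^'+] --> limn (series (fun n => ((n == 0)%N%:R : R))).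
  apply: (@cvg_series_dominated _ _ _ _ u _ (maj (1 `^ alpha))).
  - by apply: cvg_series_maj; rewrite powR_gt0.
  - case=> [|n].
      apply: (@cvg_trans _ (cst (1 : R) @ 0^'+)); last exact: cvg_cst.
      apply: near_eq_cvg; near=> h.
      have h0 : 0 < h by near: h; exact: nbhs_right_gt.
      by rewrite /u /= mul0r addr0 ppow_gt0E// (powRr1 (ltW h0)) mulVf ?gt_eqF.
    have n0 : 0 < n.+1%:R * alpha by rewrite mulr_gt0.
    have := @is_derive_term R e1 e2 q r tau tau_ge0 n.+1 (1 + n.+1%:R * alpha) 0.
    rewrite ltrDl n0 => /(_ isT) [d].
    rewrite addrAC subrr add0r (Tle0 _ _ _ n0)// mulr0 => dE.
    have := @cvg_dnbhs_at_right _ _ _ 0 _ d.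
    rewrite -/(derive _ _ _) dE; apply: cvg_trans; apply: near_eq_cvg; near=> h.
    rewrite [(_ \o _) _](_ : _ = T n.+1 (1 + n.+1%:R * alpha) h); last first.
      by rewrite -[LHS]/(T n.+1 _ (h *: 1 + 0)) [h *: 1]mulr1 addr0.
    by rewrite (Tle0 _ _ 0)// ?subr0// ltr_pwDl.
  - near=> h => n.
    have h0 : 0 < h by near: h; exact: nbhs_right_gt.
    have h1 : h <= 1 by near: h; exact: nbhs_right_le.
    have p0 : 0 <= 1 + n%:R * alpha by rewrite addr_ge0.
    rewrite /u normrM normfV (gtr0_norm h0) [leLHS]mulrC ler_pdivrMr//.
    apply: (le_trans (term_norm_le q r e1_ge0 e2_ge0 tau_ge0 n h p0)).
    rewrite ppow_gt0E// gt0_powRD// (powRr1 (ltW h0)) mulrCA mulrC ler_pM2r// /maj -mulrA.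
    apply: (@le_trans _ _ (coef e1 e2 q r n * (1 `^ alpha) ^+ n)).
      by rewrite ler_wpM2l// powR_nalpha_le// h0.
    by rewrite ler_peMl// mulr_ge0// exprn_ge0 ?powR_ge0.
apply: cvg_trans; apply: near_eq_cvg; near=> h.
rewrite /u /sol -[RHS]lim_seriesZ//; exact: is_cvg_sol.
Unshelve. all: by end_near. Qed.

End SolutionSeries.

(** * Termwise fractional integration of the series *)

Section AbelSeries.
Context {R : realType}.
Notation mu := (@lebesgue_measure R).

Lemma abel_series (e1 e2 : nat -> R) (q r tau : R) (b gamma D t : R) (k nu M : nat -> R) :
  0 <= tau -> 0 <= b < 1 -> -1 < gamma -> 0 <= D -> 0 < t ->
  (forall n, 0 <= M n) -> cvgn (series M) ->
  (forall n s, 0 < s < t ->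
     `|k n * term e1 e2 q r tau n (nu n) s| <= M n * (D * s `^ gamma)) ->
  (forall n, k n = 0 \/ (-1 < nu n /\ (0 < nu n \/ (n <= 1)%N))) ->
  mu.-integrable `]0%R, t[ (fun s => ((t - s) `^ (- b) *
     limn (series (fun n => k n * term e1 e2 q r tau n (nu n) s)))%:E) /\
  series (fun n => k n * (beta b (nu n) * term e1 e2 q r tau n (nu n + 1 - b) t)) @ \oo -->
    \int[mu]_(s in `]0%R, t[) ((t - s) `^ (- b) *
      limn (series (fun n => k n * term e1 e2 q r tau n (nu n) s))).
Proof.
move=> tau0 b01 gamma1 D0 t0 M0 cM bound kn.
set T := term e1 e2 q r tau.
pose h n s := (t - s) `^ (- b) * (k n * T n (nu n) s).
pose G s := D * ((t - s) `^ (- b) * ppow gamma s).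
have mI : measurable (`]0%R, t[%classic : set R) by exact: measurable_itv.
have mker : measurable_fun `]0%R, t[ (fun s : R => (t - s) `^ (- b)).
  apply: measurable_funTS; apply: (measurableT_comp (measurable_powR _)).
  exact: measurable_funB.
have mh n : measurable_fun `]0%R, t[ (h n).
  apply: measurable_funM => //; apply: measurable_funM => //.
  by apply: measurable_funTS; exact: measurable_term.
have iG : mu.-integrable `]0%R, t[ (EFin \o G).
  have [i _] := @abel_term R e1 e2 q r tau tau0 b gamma t 0%N b01 gamma1 (or_intror erefl) t0.
  have -> : EFin \o G = (fun s => (D%:E * ((t - s) `^ (- b) * T 0%N gamma s)%:E)%E).
    by apply/funext => s; rewrite -EFinM.
  exact: integrableZl.
have G0 s : `]0%R, t[%classic s -> 0 <= G s.
  by move=> _; rewrite /G !mulr_ge0 ?powR_ge0.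
have hG n s : `]0%R, t[%classic s -> `|h n s| <= M n * G s.
  rewrite /= in_itv/= => /[dup] st /andP[s0 _].
  rewrite /h /G normrM ger0_norm ?powR_ge0// ppow_gt0E//.
  rewrite [D * _]mulrCA [leRHS]mulrCA ler_wpM2l ?powR_ge0//; exact: bound.
have [iL cL] := @Rintegral_series_dominated R _ _ mu _ h M G mI mh iG G0 M0 cM hG.
have E s : `]0%R, t[%classic s ->
    limn (series (h ^~ s)) = (t - s) `^ (- b) * limn (series (fun n => k n * T n (nu n) s)).
  rewrite /= in_itv/= => st.
  rewrite -[RHS]lim_seriesZ//.
  apply: (is_cvg_series_dominated (fun n => bound n s st)).
  rewrite (_ : (fun n => _) = (D * s `^ gamma) *: M); first exact: is_cvg_seriesZ.
  by apply/funext => n; rewrite /= mulrC.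
have hE n : \int[mu]_(s in `]0%R, t[) h n s =
    k n * (beta b (nu n) * T n (nu n + 1 - b) t).
  have [k0|[nu1 nun]] := kn n.
    rewrite k0 mul0r /Rintegral integral0_eq// => s _.
    by rewrite /h k0 mul0r mulr0.
  have [i <-] := @abel_term R e1 e2 q r tau tau0 b (nu n) t n b01 nu1 nun t0.
  rewrite -RintegralZl//; apply: eq_Rintegral => s _; exact: mulrCA.
split.
  by apply: eq_integrable iL => // s /set_mem st; rewrite E.
have -> : (fun n => k n * (beta b (nu n) * T n (nu n + 1 - b) t)) =
    (fun n => \int[mu]_(s in `]0%R, t[) h n s) by apply/funext => n; rewrite hE.
rewrite (_ : \int[mu]_(s in `]0%R, t[) _ =
  \int[mu]_(s in `]0%R, t[) limn (series (h ^~ s)))//.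
by apply: eq_Rintegral => s /set_mem st; rewrite E.
Qed.

End AbelSeries.

(** * The growing solution and its Caputo derivatives *)

Section UnboundedSolution.
Context {R : realType}.
Notation mu := (@lebesgue_measure R).
Variables (a b c alpha tau : R).
Hypotheses (c_lt0 : c < 0) (alpha_gt : 1 < 2 * alpha) (alpha_lt : alpha < 1).
Hypotheses (ab : a < - `|b|) (tau_ge0 : 0 <= tau).

Let A : R := (Gamma (1%:R - alpha))^-1.
Let B : R := (Gamma (2%:R - 2 * alpha))^-1.

(* The factors by which the Caputo derivatives of orders alpha and 2 alpha act on
   delayed powers of exponent 1 + n alpha. *)
Definition kappa1 (n : nat) : R := A * ((1 + n%:R * alpha) * beta alpha (n%:R * alpha)).

Definition kappa2 (n : nat) : R :=
  B * ((1 + n%:R * alpha) * (n%:R * alpha) * beta (2 * alpha - 1) (n%:R * alpha - 1)).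

(** [eps1] and [eps2] come from solving the equation for the newest summand, whose derivative of
    order [2 * alpha] carries the factor [- c * kappa2]. They are nonnegative because [c] is
    negative. *)
Definition eps1 (n : nat) : R := kappa1 n / (- c * kappa2 n.+1).
Definition eps2 (n : nat) : R := (- c * kappa2 n.+2)^-1.

Let alpha_gt0 : 0 < alpha.
Proof. by have ag := alpha_gt; lra. Qed.

Let alpha01 : 0 <= alpha < 1.
Proof. by rewrite ltW. Qed.

Let alpha201 : 0 <= 2 * alpha - 1 < 1.
Proof. by have := alpha_gt; have := alpha_lt => *; apply/andP; split; lra. Qed.

Let nalpha_ge0 n : 0 <= n%:R * alpha.
Proof. by rewrite mulr_ge0// ltW. Qed.

Let nalpha_gt0 n : 0 < n.+1%:R * alpha.
Proof. by rewrite mulr_gt0. Qed.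

Let nalpha_gtN1 n : -1 < n%:R * alpha.
Proof. by rewrite (lt_le_trans _ (nalpha_ge0 n))// ltrN10. Qed.

Let A_ge0 : 0 <= A.
Proof. by rewrite invr_ge0 Gamma_ge0. Qed.

Let B_gt0 : 0 < B.
Proof.
have ag := alpha_gt; have al := alpha_lt.
by rewrite invr_gt0; apply: Gamma_gt0; apply/andP; split; lra.
Qed.

Let C_gt0 : 0 < - c.
Proof. by rewrite oppr_gt0. Qed.

Lemma kappa1_ge0 n : 0 <= kappa1 n.
Proof. by rewrite /kappa1 !mulr_ge0 ?addr_ge0// ltW// beta_gt0. Qed.

(** The lower bound of [beta_ge] is exactly the inverse of the factor [n.+1%:R * alpha]. *)
Lemma kappa2_ge n : B * (1 + n.+1%:R * alpha) <= kappa2 n.+1.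
Proof.
rewrite /kappa2 ler_pM2l// -mulrA ler_peMr ?addr_ge0//.
have h : -1 < n.+1%:R * alpha - 1 by have := nalpha_gt0 n; lra.
have := beta_ge alpha201 h; rewrite subrK => /(ler_wpM2l (nalpha_ge0 n.+1)).
by rewrite mulfV ?gt_eqF.
Qed.

Lemma kappa2_gt0 n : 0 < kappa2 n.+1.
Proof. by apply: lt_le_trans (kappa2_ge n); rewrite mulr_gt0// ltr_pwDl. Qed.

Lemma eps1_ge0 n : 0 <= eps1 n.
Proof.
by rewrite /eps1 divr_ge0 ?kappa1_ge0// mulr_ge0 ?(ltW C_gt0)// ltW// kappa2_gt0.
Qed.

Lemma eps2_ge0 n : 0 <= eps2 n.
Proof. by rewrite /eps2 invr_ge0 mulr_ge0 ?(ltW C_gt0)// ltW// kappa2_gt0. Qed.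

(** By [kappa2_ge] the linear factor of [kappa1] is compensated by the denominator, which leaves a
    multiple of a Beta value that tends to 0. *)
Lemma eps1_cvg0 : eps1 @ \oo --> 0.
Proof.
apply: (@squeeze_cvgr _ _ _ _ (cst 0) (fun n => A / (- c * B) * beta alpha (n%:R * alpha))).
- apply: nearW => n; rewrite eps1_ge0/= /eps1 /kappa1.
  rewrite ler_pdivrMr; last by rewrite mulr_gt0// kappa2_gt0.
  have b0 := beta_gt0 alpha01 (nalpha_gtN1 n).
  rewrite (_ : A / (- c * B) * beta alpha (n%:R * alpha) * (- c * kappa2 n.+1) =
    A * (kappa2 n.+1 / B * beta alpha (n%:R * alpha))); last first.
    by field; rewrite gt_eqF//= lt_eqF.
  apply: ler_wpM2l => //; rewrite ler_pM2r//.
  rewrite ler_pdivlMr// mulrC; apply: le_trans (kappa2_ge n).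
  by rewrite ler_pM2l// lerD2l ler_pM2r// ler_nat.
- exact: cvg_cst.
- rewrite -[X in _ --> X](mulr0 (A / (- c * B))); apply: cvgMl_tmp.
  exact: beta_cvg0.
Qed.

Lemma eps2_cvg0 : eps2 @ \oo --> 0.
Proof.
apply: (@squeeze_cvgr _ _ _ _ (cst 0) (fun n => (- c * B * alpha)^-1 * harmonic n)).
- apply: nearW => n; rewrite eps2_ge0/= /eps2 -invfM.
  have p1 : 0 < - c * kappa2 n.+2 by rewrite mulr_gt0// kappa2_gt0.
  have p2 : 0 < - c * B * alpha * n.+1%:R by rewrite !mulr_gt0.
  rewrite lef_pV2 ?posrE//.
  rewrite -!mulrA ler_pM2l//; apply: le_trans (kappa2_ge n.+1).
  rewrite ler_pM2l// [alpha * _]mulrC ler_wpDl// ler_pM2r// ler_nat//.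
- exact: cvg_cst.
- rewrite -[X in _ --> X](mulr0 (- c * B * alpha)^-1); apply: cvgMl_tmp.
  exact: cvg_harmonic.
Qed.

Local Notation T := (term eps1 eps2 (- a) b tau).

Definition growing_solution : R -> R := sol eps1 eps2 (- a) b tau alpha.
Local Notation x := growing_solution.
Local Notation x1 := (sol1 eps1 eps2 (- a) b tau alpha).
Local Notation x2 := (sol2 eps1 eps2 (- a) b tau alpha).

Let dx (s : R) : 0 < s -> is_derive s 1 x (x1 s).
Proof.
exact: (is_derive_sol (- a) b eps1_ge0 eps2_ge0 eps1_cvg0 eps2_cvg0 tau_ge0 alpha_gt alpha_lt).
Qed.

Let dx1 (s : R) : 0 < s -> is_derive s 1 x1 (x2 s).
Proof.
exact: (is_derive_sol1 (- a) b eps1_ge0 eps2_ge0 eps1_cvg0 eps2_cvg0 tau_ge0 alpha_gt alpha_lt).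
Qed.

Let derive1n1_x (s : R) : 0 < s -> derive1n 1 x s = x1 s.
Proof. by move=> /dx d; rewrite derive1n1 derive1E derive_val. Qed.

Let near_derive1n1_x (s : R) : 0 < s -> \forall z \near s, x1 z = derive1n 1 x z.
Proof.
move=> s0; near=> z; rewrite derive1n1_x//; near: z; exact: lt_nbhsr.
Unshelve. all: by end_near. Qed.

Let is_derive_derive1n1_x (s : R) : 0 < s -> is_derive s 1 (derive1n 1 x) (x2 s).
Proof.
by move=> s0; apply: near_eq_is_derive (dx1 s0); exact: near_derive1n1_x.
Qed.

Let derive1n2_x (s : R) : 0 < s -> derive1n 2 x s = x2 s.
Proof.
move=> /is_derive_derive1n1_x d.
by rewrite -[LHS]/(derive1 (derive1n 1 x) s) derive1E derive_val.
Qed.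

Let caputo_order1 : caputo_order alpha = 1%N.
Proof.
rewrite /caputo_order (_ : Num.ceil alpha = 1)//; apply: ceil_def.
by rewrite subrr alpha_gt0 ltW.
Qed.

Let caputo_order2 : caputo_order (2 * alpha) = 2%N.
Proof.
rewrite /caputo_order (_ : Num.ceil (2 * alpha) = 2)//; apply: ceil_def.
rewrite alpha_gt/= ler_piMr// ltW//.
Qed.

Let kernel1 t s : `]0%R, t[%classic s ->
  caputo_kernel alpha x t s = (t - s) `^ (- alpha) * x1 s.
Proof.
rewrite /= in_itv/= => /andP[s0 _]; rewrite /caputo_kernel caputo_order1 derive1n1_x//.
by congr (_ `^ _ * _); ring.
Qed.

Let kernel2 t s : `]0%R, t[%classic s ->
  caputo_kernel (2 * alpha) x t s = (t - s) `^ (- (2 * alpha - 1)) * x2 s.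
Proof.
rewrite /= in_itv/= => /andP[s0 _]; rewrite /caputo_kernel caputo_order2 derive1n2_x//.
by congr (_ `^ _ * _); ring.
Qed.

Let series1 t : 0 < t ->
  mu.-integrable `]0%R, t[ (fun s => ((t - s) `^ (- alpha) * x1 s)%:E) /\
  series (fun n => (1 + n%:R * alpha) *
     (beta alpha (n%:R * alpha) * T n (n%:R * alpha + 1 - alpha) t)) @ \oo -->
  \int[mu]_(s in `]0%R, t[) ((t - s) `^ (- alpha) * x1 s).
Proof.
move=> t0.
(* The first derivative is bounded near 0, hence [gamma = 0] and [D = 1]. *)
apply: (@abel_series R eps1 eps2 (- a) b tau alpha 0 1 t (fun n => 1 + n%:R * alpha)
  (fun n => n%:R * alpha) (maj eps1 eps2 (- a) b (t `^ alpha))) => //.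
- by move=> n; rewrite maj_ge0// ?powR_ge0//; [exact: eps1_ge0|exact: eps2_ge0].
- apply: cvg_series_maj => //; by [exact: eps1_ge0|exact: eps2_ge0
    |exact: eps1_cvg0|exact: eps2_cvg0|exact: powR_gt0].
- move=> n s /andP[s0 st]; rewrite powRr0 !mulr1.
  apply: sol1_term_bound => //; [exact: eps1_ge0|exact: eps2_ge0|by rewrite s0 ltW].
- move=> n; right; split=> //; case: n => [|n]; [by right|by left].
Qed.

Let series2 t : 0 < t ->
  mu.-integrable `]0%R, t[ (fun s => ((t - s) `^ (- (2 * alpha - 1)) * x2 s)%:E) /\
  series (fun n => (1 + n%:R * alpha) * (n%:R * alpha) *
     (beta (2 * alpha - 1) (n%:R * alpha - 1) *
      T n (n%:R * alpha - 1 + 1 - (2 * alpha - 1)) t)) @ \oo -->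
  \int[mu]_(s in `]0%R, t[) ((t - s) `^ (- (2 * alpha - 1)) * x2 s).
Proof.
move=> t0.
(* The exponent [alpha - 1] and the constant are those of [sol2_term_bound] with [H = t]. *)
apply: (@abel_series R eps1 eps2 (- a) b tau (2 * alpha - 1) (alpha - 1) (t `^ alpha)^-1 t
  (fun n => (1 + n%:R * alpha) * (n%:R * alpha))
  (fun n => n%:R * alpha - 1) (maj eps1 eps2 (- a) b (t `^ alpha))) => //.
- by rewrite ltrBrDl subrr.
- by rewrite invr_ge0 powR_ge0.
- by move=> n; rewrite maj_ge0// ?powR_ge0//; [exact: eps1_ge0|exact: eps2_ge0].
- apply: cvg_series_maj => //; by [exact: eps1_ge0|exact: eps2_ge0
    |exact: eps1_cvg0|exact: eps2_cvg0|exact: powR_gt0].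
- move=> n s /andP[s0 st].
  apply: sol2_term_bound => //; [exact: eps1_ge0|exact: eps2_ge0|by rewrite s0 ltW].
- case=> [|n]; first by left; rewrite mul0r mulr0.
  right; split; first by rewrite ltrBrDl subrr.
  case: n => [|n]; [by right|left]; rewrite subr_gt0 (lt_le_trans alpha_gt)//.
  by rewrite ler_pM2r// ler_nat.
Qed.

Let caputo1E t : 0 < t ->
  series (fun n => kappa1 n * T n (n%:R * alpha + 1 - alpha) t) @ \oo --> caputo alpha x t.
Proof.
move=> t0; rewrite /caputo caputo_order1 lt_eqF//.
have -> : \int[mu]_(s in `]0%R, t[) caputo_kernel alpha x t s =
    \int[mu]_(s in `]0%R, t[) ((t - s) `^ (- alpha) * x1 s).
  by apply: eq_Rintegral => s /set_mem; exact: kernel1.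
rewrite -/A (_ : (fun n => _) = A *: (fun n => (1 + n%:R * alpha) *
     (beta alpha (n%:R * alpha) * T n (n%:R * alpha + 1 - alpha) t))).
  by rewrite seriesZ; apply: cvgMl_tmp; exact: (series1 t0).2.
by apply/funext => n; rewrite /kappa1 -[RHS]/(A * _) -!mulrA.
Qed.

Let caputo2E t : 0 < t ->
  series (fun n => kappa2 n * T n (n%:R * alpha - 1 + 1 - (2 * alpha - 1)) t) @ \oo -->
    caputo (2 * alpha) x t.
Proof.
move=> t0; rewrite /caputo caputo_order2 lt_eqF; last first.
  by rewrite gtr_pMr.
have -> : \int[mu]_(s in `]0%R, t[) caputo_kernel (2 * alpha) x t s =
    \int[mu]_(s in `]0%R, t[) ((t - s) `^ (- (2 * alpha - 1)) * x2 s).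
  by apply: eq_Rintegral => s /set_mem; exact: kernel2.
rewrite -/B (_ : (fun n => _) = B *: (fun n => (1 + n%:R * alpha) * (n%:R * alpha) *
     (beta (2 * alpha - 1) (n%:R * alpha - 1) *
      T n (n%:R * alpha - 1 + 1 - (2 * alpha - 1)) t))).
  by rewrite seriesZ; apply: cvgMl_tmp; exact: (series2 t0).2.
by apply/funext => n; rewrite /kappa2 -[RHS]/(B * _) -!mulrA.
Qed.

Let defined1 t : 0 < t -> caputo_defined alpha x t.
Proof.
move=> t0; rewrite /caputo_defined caputo_order1; split.
  by move=> [|//] s _ /andP[s0 _]; have := dx s0 => d; exact: ex_derive.
move=> _; apply: eq_integrable (series1 t0).1 => // s /set_mem st.
by rewrite kernel1.
Qed.

Let defined2 t : 0 < t -> caputo_defined (2 * alpha) x t.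
Proof.
move=> t0; rewrite /caputo_defined caputo_order2; split.
  move=> [|[|//]] s _ /andP[s0 _]; first by have := dx s0 => d; exact: ex_derive.
  by have := is_derive_derive1n1_x s0 => d; exact: ex_derive.
move=> _; apply: eq_integrable (series2 t0).1 => // s /set_mem st.
by rewrite kernel2.
Qed.

Let cvg_x t : series (fun n => T n (1 + n%:R * alpha) t) @ \oo --> x t.
Proof.
apply: (@is_cvg_sol R eps1 eps2 (- a) b tau alpha) => //;
  by [exact: eps1_ge0|exact: eps2_ge0|exact: eps1_cvg0|exact: eps2_cvg0].
Qed.

(* The choice of [eps1] and [eps2] makes the partial sums telescope. *)
Let partial_sums t n :
  series (fun n => kappa1 n * T n (n%:R * alpha + 1 - alpha) t) n.+1 +
  c * series (fun n => kappa2 n * T n (n%:R * alpha - 1 + 1 - (2 * alpha - 1)) t) n.+2 =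
  a * series (fun n => T n (1 + n%:R * alpha) t) n +
  b * series (fun n => T n (1 + n%:R * alpha) (t - tau)) n.
Proof.
have c0 : c != 0 by rewrite lt_eqF.
set U := fun n => kappa1 n * _; set V := fun n => kappa2 n * _.
set Y := fun n => T n _ t; set Z := fun n => T n _ (t - tau).
(* The offsets by one and two have this origin: [V 0] vanishes, [U 0] cancels against [c * V 1], and
   from there on [U m.+1 + c * V m.+2] matches the m-th summands of the right-hand side. *)
have V0 : V 0%N = 0 by rewrite /V /kappa2 !mul0r mulr0 mul0r mulr0 mul0r.
have UV1 : U 0%N + c * V 1%N = 0.
  rewrite /U /V.
  have -> : 1%:R * alpha - 1 + 1 - (2 * alpha - 1) = 0%:R * alpha + 1 - alpha by ring.
  have -> : T 1%N (0%:R * alpha + 1 - alpha) t = eps1 0 * T 0%N (0%:R * alpha + 1 - alpha) t by [].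
  by have k0 := kappa2_gt0 0; rewrite /eps1; field; rewrite c0 gt_eqF.
have UVYZ m : U m.+1 + c * V m.+2 = a * Y m + b * Z m.
  rewrite /U /V /Y /Z.
  have -> : m.+2%:R * alpha - 1 + 1 - (2 * alpha - 1) = 1 + m%:R * alpha.
    by rewrite -(natr1 m.+1) -(natr1 m); ring.
  have -> : m.+1%:R * alpha + 1 - alpha = 1 + m%:R * alpha.
    by rewrite -(natr1 m); ring.
  rewrite termSS /eps1 /eps2.
  by have k0 := kappa2_gt0 m.+1; field; rewrite c0 gt_eqF.
have sS (u : R^nat) m : series u m.+1 = series u m + u m by exact: seriesSr.
have s0 (u : R^nat) : series u 0%N = 0 by rewrite /series/= big_geq.
elim: n => [|n IH].
  by rewrite !sS !s0 V0 !add0r !mulr0 addr0.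
by rewrite (sS U n.+1) (sS V n.+2) mulrDr addrACA IH UVYZ !sS !mulrDr addrACA.
Qed.

Let equation t : 0 < t ->
  caputo alpha x t + c * caputo (2 * alpha) x t = a * x t + b * x (t - tau).
Proof.
move=> t0.
have l1 := caputo1E t0; have l2 := caputo2E t0.
rewrite -(cvg_shiftn 1) in l1; rewrite -(cvg_shiftn 2) in l2.
have L := cvgD l1 (cvgM (cvg_cst c) l2).
have L' := cvgD (cvgM (cvg_cst a) (@cvg_x t)) (cvgM (cvg_cst b) (@cvg_x (t - tau))).
rewrite -(cvg_lim (@Rhausdorff R) (L _ _ _)); apply: (cvg_lim (@Rhausdorff R)).
apply: cvg_trans (L' _ _ _ _ _); apply: near_eq_cvg; apply: nearW => n.
by rewrite !fctE/= addn1 addn2 partial_sums.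
Qed.

(** All summands are nonnegative and the one of index 0 is [t], so the first partial sum is already
    a lower bound. *)
Lemma growing_solution_ge t : 0 < t -> t <= x t.
Proof.
move=> t0.
have T0 n : 0 <= T n (1 + n%:R * alpha) t.
  apply: term_diag1_ge0 => //; [exact: eps1_ge0|exact: eps2_ge0|].
  by rewrite lerNr ltW.
have := @series_le_lim _ _ 1 T0 (cvgP _ (@cvg_x t)).
rewrite {1}/series/= big_nat1 /= mul0r addr0 ppow_gt0E// (powRr1 (ltW t0)).
exact.
Qed.

Lemma growing_solution_is_solution : is_solution a b c alpha tau (cst 0) 1 x.
Proof.
split.
- apply: continuous_subspaceT; apply: continuous_sol => //;
  by [exact: eps1_ge0|exact: eps2_ge0|exact: eps1_cvg0|exact: eps2_cvg0].
- move=> t; rewrite in_itv/= => /andP[_ t0]; apply: sol_le0 => //;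
  by [exact: eps1_ge0|exact: eps2_ge0].
- apply: sol_right_derivative => //;
  by [exact: eps1_ge0|exact: eps2_ge0|exact: eps1_cvg0|exact: eps2_cvg0].
- move=> t t0; split; [exact: defined1|exact: defined2|exact: equation].
Qed.

Lemma unstable_any_delay : unstable a b c alpha tau.
Proof.
move=> /(_ _ _ _ growing_solution_is_solution) bx.
have : \forall M \near +oo, \forall t \near +oo, `|x t| <= M by exact: bx.
case=> M [_ HM].
have /HM : M < Num.max M 0 + 1 by rewrite ltr_pwDr// le_max lexx.
case=> N [_ HN].
(* This time lies beyond [N] and exceeds the supposed bound [Num.max M 0 + 1], which contradicts
   [t <= x t]. *)
pose t := Num.max N (Num.max M 0 + 1) + 1.
have /HN : N < t by rewrite /t ltr_pwDr// le_max lexx.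
have h1 : Num.max M 0 + 1 < t by rewrite /t ltr_pwDr// le_max lexx orbT.
have t0 : 0 < t by apply: lt_trans h1; rewrite ltr_pwDr// le_max lexx orbT.
rewrite /= leNgt => /negP; apply; apply: (lt_le_trans h1).
exact: le_trans (growing_solution_ge t0) (ler_norm _).
Qed.

End UnboundedSolution.

(* Independence of the delay *)
Local Close Scope classical_set_scope.

Theorem mainTheorem3 (R : realType) (a b c alpha : R)
  (hc : c < 0) (halpha : 2^-1 < alpha < 1) (hab : a < - `|b|) :
  stability_delay_independent a b c alpha.
Proof.
case/andP: halpha => halpha1 halpha2.
have ha : 1 < 2 * alpha by rewrite -ltr_pdivrMl// mulr1.
have U tau : 0 <= tau -> unstable a b c alpha tau by exact: unstable_any_delay.
(* The first implication is vacuous, as the equation without delay is itself unstable. *)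
by split=> [S|_] tau tau0; [case: (U 0 (lexx 0))|exact: U].
Qed.
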